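(* Let $\varepsilon>0$ and $\delta\in(0,1)$. Let the number of samples be $N_x=\Omega\left(\lambda_0^{-2}(d-\log(\delta))\right)$. Assume the step size $\eta>0$ for gradient descent satisfies $$\eta\le \frac{4/3}{8(1+|\mu_0|^2)+4\|\Sigma_0\|_2+\lambda_0}.$$ Then the gradient descent method on the empirical loss, $$\theta^{(k+1)}=\theta^{(k)}-\eta\,\nabla_\theta\widehat{L}\left(\theta^{(k)},\{x^{(n)}\}_{n=1}^{N_x}\right),$$ satisfies $$\Pr\left(\widehat{L}\left(\theta^{(K)},\{x^{(n)}\}_{n=1}^{N_x}\right)\le\varepsilon\right)\ge 1-\delta$$ after $K=\Omega\left(\log(\varepsilon^{-1})(\eta\lambda_0)^{-1}\right)$ steps.
   Context: Setting: one-step flow matching (a forward Euler discretization with a single time step) for the Ornstein--Uhlenbeck process $\mathrm{d}x_t=b(x_t)\,\mathrm{d}t+\sqrt{2\gamma}\,\mathrm{d}W_t$ in $\mathbb{R}^d$ with $x_0\sim N(\mu_0,\Sigma_0)$, where $W_t$ is a standard Brownian motion, $\gamma>0$, $\mu_0\in\mathbb{R}^d$, $\Sigma_0\in\mathbb{R}^{d\times d}$ is a positive definite covariance matrix, and $b(x)=B_1x+b_0$ with $B_1\in\mathbb{R}^{d\times d}$, $b_0\in\mathbb{R}^d$. The velocity field is parametrized linearly as $f(x;\theta)=\Theta_1x+\theta_0$ with parameter $\theta=(\theta_0,\Theta_1)\in\mathbb{R}^d\times\mathbb{R}^{d\times d}$. The score function of the initial density is $s(x)=-\Sigma_0^{-1}(x-\mu_0)$.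 Let $\{x^{(n)}\}_{n=1}^{N_x}$ be $N_x$ i.i.d. samples drawn from $N(\mu_0,\Sigma_0)$; they are drawn once and not resampled during the gradient descent, and the probability is over these samples. The empirical loss, i.e. the sample average of $|f(x;\theta)-b(x)+\gamma s(x)|^2$, is $$\widehat{L}\left(\theta,\{x^{(n)}\}_{n=1}^{N_x}\right)=\frac1{N_x}\sum_{n=1}^{N_x}\left|\Theta_1x^{(n)}+\theta_0-(B_1x^{(n)}+b_0)-\gamma\Sigma_0^{-1}(x^{(n)}-\mu_0)\right|^2.$$ Let $\sigma_0$ be the smallest eigenvalue of $\Sigma_0$ and $$\lambda_0=\frac12\left(1+\sigma_0+|\mu_0|^2-\sqrt{\left(1+\sigma_0+|\mu_0|^2\right)^2-4\sigma_0}\right).$$ The iterates start from an initial parameter $\theta^{(0)}$, and $\theta^{(K)}$ is the parameter after $K$ gradient descent steps. $|\cdot|$ is the Euclidean norm of a vector, $\|\cdot\|_2$ is the $\ell_2$ operator norm of a matrix, $\nabla_\theta$ is the gradient with respect to all entries of $(\theta_0,\Theta_1)$, and $\Omega(\cdot)$ is the usual order notation (at least a constant multiple of the argument, the constant being left unspecified).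
   Formalization: The step count K is at least C·log(1/min(ε,ε₀))/(ηλ₀), with C absolute and ε₀>0 depending only on the problem data and θ^(0); with log(1/ε) itself the claim fails for ε near or above 1 (e.g. ε=1, K=0, large initial loss). *)

(* Defs.v *)
From HB Require Import structures.
From mathcomp Require Import all_boot all_order all_algebra.
From mathcomp Require Import all_classical all_reals all_analysis.

Set Implicit Arguments.
Unset Strict Implicit.
Unset Printing Implicit Defensive.

Import Order.TTheory GRing.Theory Num.Theory.
Import numFieldNormedType.Exports.

Local Open Scope classical_set_scope.
Local Open Scope ring_scope.

Section LinearAlgebra.
Context {R : realType} {d : nat}.
Implicit Types (v : 'cV[R]_d) (A : 'M[R]_d).

(* The norm `|v| of the library is the sup norm. *)
Definition enorm v : R := Num.sqrt (\sum_(i < d) v i 0 ^+ 2).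

Definition opnorm2 A : R := sup [set enorm (A *m v) | v in [set v | enorm v <= 1]].

Definition posdef A : Prop :=
  A^T = A /\ forall v, v != 0 -> 0 < (v^T *m A *m v) 0 0.

Definition smallest_eigenvalue A (s : R) : Prop :=
  eigenvalue A s /\ forall a : R, eigenvalue A a -> s <= a.

Definition lambda0 (s : R) (mu : 'cV[R]_d) : R :=
  let c := 1 + s + enorm mu ^+ 2 in
  2^-1 * (c - Num.sqrt (c ^+ 2 - 4 * s)).

End LinearAlgebra.

Section Sampling.
Context {R : realType} {disp : measure_display} {T : measurableType disp}.
Context (P : probability T R) {d : nat}.

Definition borel : set (set 'cV[R]_d) := <<s @open 'cV[R]_d >>.

Definition random_vector (X : T -> 'cV[R]_d) : Prop :=
  forall A, borel A -> measurable (X @^-1` A).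

(* N(mu, Sigma) for a positive definite Sigma: every linear functional u^T X
   with u != 0 has the law N(u^T mu, u^T Sigma u). The second parameter of
   normal_prob is the standard deviation; u = 0 is left out because
   normal_prob m 0 is not a point mass. *)
Definition gaussian_vector (mu : 'cV[R]_d) (Sigma : 'M[R]_d)
    (X : T -> 'cV[R]_d) : Prop :=
  random_vector X /\
  forall u : 'cV[R]_d, u != 0 ->
  forall A : set R, measurable A ->
    P [set w | A ((u^T *m X w) 0 0)] =
    normal_prob ((u^T *m mu) 0 0) (Num.sqrt ((u^T *m Sigma *m u) 0 0)) A.

(* Subfamilies are covered by taking A n = setT. *)
Definition mutually_independent (N : nat) (X : 'I_N -> T -> 'cV[R]_d) : Prop :=
  forall A : 'I_N -> set 'cV[R]_d, (forall n, borel (A n)) ->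
    P (\bigcap_(n in [set: 'I_N]) (X n @^-1` A n)) =
    (\prod_(n < N) P (X n @^-1` A n))%E.

Definition iid_gaussian (mu : 'cV[R]_d) (Sigma : 'M[R]_d) (N : nat)
    (X : 'I_N -> T -> 'cV[R]_d) : Prop :=
  (forall n, gaussian_vector mu Sigma (X n)) /\ mutually_independent X.

End Sampling.

Section FlowMatching.
Context {R : realType} {d : nat}.

(* A parameter theta = (theta_0, Theta_1). *)
Definition params : Type := ('cV[R]_d * 'M[R]_d)%type.

Definition velocity (theta : params) (x : 'cV[R]_d) : 'cV[R]_d :=
  theta.2 *m x + theta.1.

Definition drift (B1 : 'M[R]_d) (b0 : 'cV[R]_d) (x : 'cV[R]_d) : 'cV[R]_d :=
  B1 *m x + b0.

Definition score (mu : 'cV[R]_d) (Sigma : 'M[R]_d) (x : 'cV[R]_d) : 'cV[R]_d :=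
  - (invmx Sigma *m (x - mu)).

Definition empirical_loss (gamma : R) (mu : 'cV[R]_d) (Sigma B1 : 'M[R]_d)
    (b0 : 'cV[R]_d) (N : nat) (x : 'I_N -> 'cV[R]_d) (theta : params) : R :=
  N%:R^-1 * \sum_(n < N)
    enorm (velocity theta (x n) - drift B1 b0 (x n)
           + gamma *: score mu Sigma (x n)) ^+ 2.

Definition gradient (L : 'cV[R]_d * 'M[R]_d -> R) (theta : params) : params :=
  (\col_i 'D_(delta_mx i 0, 0) L theta,
   \matrix_(i, j) 'D_(0, delta_mx i j) L theta).

Definition gd_iterate (L : params -> R) (eta : R) (theta : params) (k : nat) :
    params :=
  iter k (fun t : 'cV[R]_d * 'M[R]_d => t - eta *: gradient L t) theta.

End FlowMatching.
Arguments params : clear implicits.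

(* Main.v *)
Require Import Defs.
From HB Require Import structures.
From mathcomp Require Import all_boot all_order all_algebra.
From mathcomp Require Import all_classical all_reals all_analysis.
From mathcomp Require Import measurable_realfun ring lra.

Set Implicit Arguments.
Unset Strict Implicit.
Unset Printing Implicit Defensive.

Import Order.TTheory GRing.Theory Num.Theory.
Import numFieldNormedType.Exports HBNNSimple.

Local Open Scope classical_set_scope.
Local Open Scope ring_scope.

(* Writing y = (1, x) and E for the parameter minus its minimiser, the empirical
   loss is tr (E G E^T) with G the Gram matrix of the augmented samples, and a
   gradient step is E |-> E (1 - 2 eta G). If G lies between lambda0 / 16 and
   (5/2) (1 + |mu0|^2 + ||Sigma0||), each step contracts the loss by
   1 - eta lambda0 / 24. The bounds on G are relative to M = E[y y^T], which is
   why only lambda0 <= 1 enters the number of samples: for a fixed v, v.y is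
   N(a, s^2) with a^2 + s^2 = v^T M v, and a Chernoff bound controls the mean of
   (v.y)^2 up to probability exp (- N / 12). In coordinates where M is the
   identity (Cholesky) a union bound over the integer points of a scaled ball,
   of which there are at most 2^(12 (d + 1)), extends this to all v. *)

(** The loss can be driven to zero because [b - gamma s] is affine in [x], so the target belongs to
    the parametrized family. The same samples enter every step, so the iterates depend on them and a
    concentration bound at each iterate would not apply. One event on which G is bounded in all
    directions has to serve every step at once; it involves neither the initial parameter nor [K].
    Since [gaussian_vector] prescribes only the laws of linear forms, all probability is done on the
    line, one form at a time. For a fixed direction the mean of [(v.y)^2] is kept between 1/4 and 2
    times its expectation. Such crude factors already fail with exponentially small probability, and
    passing from a net of mesh 1/10 to all directions weakens them only to 1/16 and 5/2. The step
    size hypothesis leaves room for this: it gives [eta * Lam <= 1/3] for the population bound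
    [Lam], hence [eta * (5/2) * Lam <= 5/6], still below the value 1 at which the contraction
    argument would break. *)

(** * Exponential moments of a squared Gaussian *)

(** Linearity settles simple functions and monotone convergence the rest. It serves twice: with
    [phi] the identity and [g] a normal density, and with [phi] one random variable and [g] the
    product of the factors at the other indices. *)
Lemma integral_change_of_density (R : realType) (d1 d2 : measure_display)
    (T : measurableType d1) (S : measurableType d2)
    (mu : {measure set T -> \bar R}) (kappa : {measure set S -> \bar R})
    (phi : T -> S) (g : T -> R) (f : S -> R) :
  measurable_fun setT phi -> measurable_fun setT g -> measurable_fun setT f ->
  (forall x, 0 <= g x) -> (forall y, 0 <= f y) ->
  (forall A, measurable A ->
    kappa A = \int[mu]_x (\1_A (phi x) * g x)%:E)%E ->
  (\int[kappa]_y (f y)%:E = \int[mu]_x (f (phi x) * g x)%:E)%E.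
Proof.
move=> mphi mg mf g0 f0 kappaE.
have /measurable_EFinP mf' := mf.
pose f_ := nnsfun_approx measurableT mf'.
have f_cvg y : (f_ n y)%:E @[n --> \oo] --> (f y)%:E.
  by apply: (cvg_nnsfun_approx measurableT mf') => // z _; rewrite lee_fin f0.
have f_nd y : {homo (fun n => f_ n y) : n m / (n <= m)%N >-> n <= m}.
  by move=> n m nm; have /lefP := nd_nnsfun_approx measurableT mf' nm; exact.
have f_simple n :
    (\int[kappa]_y (f_ n y)%:E = \int[mu]_x (f_ n (phi x) * g x)%:E)%E.
  rewrite integralT_nnsfun sintegralE.
  under [RHS]eq_integral => x _.
    rewrite fimfunE mulrC mulr_fsumr -fsumEFin//.
    under eq_fsbigr do rewrite mulrCA [g x * _]mulrC EFinM.
    over.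
  rewrite ge0_integral_fsum//=; last 2 first.
  - move=> r; apply: emeasurable_funM => //; apply/measurable_EFinP.
    apply: measurable_funM => //.
    exact: (measurableT_comp (measurable_indic (measurable_sfunP _ _))).
  - move=> r x _; have [r0|r0] := leP 0 r.
      by rewrite mule_ge0 ?lee_fin ?mulr_ge0.
    rewrite preimage_nnfun0// indic0/= mul0r mule0//.
  apply: eq_fsbigr => r; rewrite inE => -[y _ <-].
  rewrite ge0_integralZl_EFin//; first by rewrite kappaE.
    by move=> x _; rewrite lee_fin mulr_ge0.
  apply/measurable_EFinP; apply: measurable_funM => //.
  exact: (measurableT_comp (measurable_indic (measurable_sfunP _ _))).
transitivity (limn (fun n => \int[kappa]_y (f_ n y)%:E))%E.
  rewrite -monotone_convergence//.
  - by apply: eq_integral => y _; apply/esym/cvg_lim => //; exact: f_cvg.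
  - by move=> n; apply/measurable_EFinP.
  - by move=> n y _; rewrite lee_fin.
  - by move=> y _ n m nm; rewrite lee_fin f_nd.
under eq_fun do rewrite f_simple.
rewrite -monotone_convergence//.
- apply: eq_integral => x _; apply/cvg_lim => //.
  under eq_fun do rewrite EFinM.
  rewrite EFinM; apply: cvgeZr => //; exact: f_cvg.
- move=> n; apply/measurable_EFinP; apply: measurable_funM => //.
  exact: measurableT_comp.
- by move=> n y _; rewrite lee_fin mulr_ge0.
- by move=> y _ n m nm; rewrite lee_fin ler_wpM2r// f_nd.
Qed.

(* Completing the square turns the integrand into a multiple of another normal
   density. *)
Lemma normal_prob_expR_sqr (R : realType) (m s c l : R) : s != 0 ->
  2 * l * s ^+ 2 < 1 ->
  (\int[normal_prob m s]_x (expR (l * (c + x) ^+ 2))%:E =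
   ((Num.sqrt (1 - 2 * l * s ^+ 2))^-1 *
    expR (l * (c + m) ^+ 2 / (1 - 2 * l * s ^+ 2)))%:E)%E.
Proof.
move=> s0 ls.
have q0 : 0 < 1 - 2 * l * s ^+ 2 by rewrite subr_gt0.
rewrite (@integral_change_of_density _ _ _ _ _ lebesgue_measure _ idfun
  (normal_pdf m s) (fun x => expR (l * (c + x) ^+ 2))) => //; first last.
- move=> A mA; rewrite [LHS]integral_mkcond; apply: eq_integral => x _.
  rewrite patchE indicE; case: ifPn => _; rewrite ?mul1r ?mul0r//.
- by move=> x; exact: normal_pdf_ge0.
- apply: measurableT_comp => //; apply: measurable_funM => //.
  by apply: measurable_funX; apply: measurable_funD.
- exact: measurable_normal_pdf.
- exact: measurable_id.
set q := 1 - 2 * l * s ^+ 2 in q0 *.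
pose s' := s / Num.sqrt q.
have sq0 : 0 < Num.sqrt q by rewrite sqrtr_gt0.
have s'0 : s' != 0 by rewrite mulf_neq0// invr_neq0// gt_eqF.
(* In the variable [c + x] the completed square is centred at [(m + c) / q] and has variance
   [s ^+ 2 / q]. *)
pose m' := (m + c) / q - c.
pose C := (Num.sqrt q)^-1 * expR (l * (c + m) ^+ 2 / q).
transitivity (\int[lebesgue_measure]_x (C%:E * (normal_pdf m' s' x)%:E))%E; last first.
  rewrite ge0_integralZl_EFin//.
  - by rewrite integral_normal_pdf mule1.
  - by move=> x _; rewrite lee_fin normal_pdf_ge0.
  - by apply/measurable_EFinP; exact: measurable_normal_pdf.
  - by rewrite mulr_ge0// ?invr_ge0 ?sqrtr_ge0 ?expR_ge0.
apply: eq_integral => x _; rewrite -EFinM; congr EFin.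
rewrite !normal_pdfE// /normal_peak /normal_fun /C.
have s'2 : s' ^+ 2 = s ^+ 2 / q by rewrite expr_div_n sqr_sqrtr// ltW.
rewrite mulrCA -expRD [RHS]mulrACA -expRD; congr (_ * expR _).
  rewrite -invfM -sqrtrM ?ltW// s'2; congr (Num.sqrt _)^-1.
  by field; rewrite gt_eqF.
rewrite s'2 /m'; have : 1 - 2 * l * s ^+ 2 = q by [].
have s20 : s ^+ 2 != 0 by rewrite expf_neq0.
have qn : q != 0 by rewrite gt_eqF.
move=> qE.
have -> : l = (1 - q) / (2 * s ^+ 2) by rewrite -qE; field.
by rewrite [idfun x]/=; field; rewrite s0 qn.
Qed.

(** With [q = 1 - 2 l s^2], the claim reduces to [1/q <= exp (2 l s^2 / q) = exp (1/q - 1)], an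
    instance of [1 + x <= exp x]. The sign of [l] does not matter, so both tails can use it. *)
Lemma gaussian_mgf_bound (R : realType) (a s l : R) : 2 * l * s ^+ 2 < 1 ->
  (Num.sqrt (1 - 2 * l * s ^+ 2))^-1 * expR (l * a ^+ 2 / (1 - 2 * l * s ^+ 2))
  <= expR (l * (a ^+ 2 + s ^+ 2) / (1 - 2 * l * s ^+ 2)).
Proof.
move=> ls; set q := 1 - _.
have q0 : 0 < q by rewrite subr_gt0.
rewrite mulrDr mulrDl expRD [leRHS]mulrC ler_wpM2r ?expR_ge0//.
rewrite -[leRHS]ger0_norm ?expR_ge0// -sqrtr_sqr -sqrtrV ?(ltW q0)//.
rewrite ler_sqrt ?exprn_gt0 ?expR_gt0//.
rewrite -expRM_natl; apply: le_trans (expR_ge1Dx _).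
rewrite le_eqVlt; apply/orP; left; apply/eqP.
have : q = 1 - 2 * l * s ^+ 2 by [].
have qn : q != 0 by rewrite gt_eqF.
move=> qE; have -> : l * s ^+ 2 = (1 - q) / 2 by rewrite qE; field.
by field.
Qed.

(** * Independence and the Chernoff bound *)

Section Independence.
Context (R : realType) (d : measure_display) (T : measurableType d).
Context (P : probability T R) (N : nat) (Y : 'I_N -> T -> R).
Hypothesis mY : forall n, measurable_fun setT (Y n).
Hypothesis indepY : forall A : 'I_N -> set R, (forall n, measurable (A n)) ->
  P (\bigcap_(n in setT) (Y n @^-1` A n)) = (\prod_(n < N) P (Y n @^-1` A n))%E.

(* The [h n] are replaced one index at a time: with the others frozen, both
   sides are measures in the indicator put at that index. *)
Lemma expectation_prod_independent (h : 'I_N -> R -> R) (e : 'I_N -> R) :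
  (forall n, measurable_fun setT (h n)) -> (forall n x, 0 <= h n x) ->
  (forall n, \int[P]_w (h n (Y n w))%:E = (e n)%:E)%E ->
  (\int[P]_w (\prod_(n < N) h n (Y n w))%:E = (\prod_(n < N) e n)%:E)%E.
Proof.
move=> mh h0 he.
pose indicator (f : R -> R) := exists2 A : set R, measurable A & f = \1_A.
(* [s] lists the indices whose factor is still arbitrary. When it is empty, all factors are
   indicators and [indepY] concludes. *)
suff H (s : seq 'I_N) : forall (h : 'I_N -> R -> R) (e : 'I_N -> R),
    (forall n, measurable_fun setT (h n)) -> (forall n x, 0 <= h n x) ->
    (forall n, \int[P]_w (h n (Y n w))%:E = (e n)%:E)%E ->
    (forall n, n \notin s -> indicator (h n)) ->
    (\int[P]_w (\prod_(n < N) h n (Y n w))%:E = (\prod_(n < N) e n)%:E)%E.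
  by apply: (H (index_enum 'I_N)) => // n; rewrite mem_index_enum.
elim: s => [|i s IH] {mh h0 he e h} h e mh h0 he hs.
  have /(_ _)/cid2 hA n : indicator (h n) by exact: hs.
  pose A n := projT1 (sig_of_sig2 (hA n)).
  have mA n : measurable (A n) by rewrite /A; case: (hA n).
  have hAE n : h n = \1_(A n) by rewrite /A; case: (hA n).
  have mYA n : measurable (Y n @^-1` A n) by rewrite -[X in measurable X]setTI; exact: mY.
  have Ye n : P (Y n @^-1` A n) = (e n)%:E.
    rewrite -he -[X in P X]setIT -integral_indic//.
    by apply: eq_integral => w _; rewrite hAE.
  transitivity (P (\bigcap_(n in setT) (Y n @^-1` A n))).
    rewrite -[X in _ = P X]setIT -integral_indic//; last first.
      by apply: fin_bigcap_measurable.
    apply: eq_integral => w _; congr EFin; rewrite indicE.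
    have [/set_mem wA|/negP wA] := boolP (w \in _).
      by rewrite big1// => n _; rewrite hAE indicE mem_set//; exact: wA.
    have /existsNP[n /not_implyP[_ wn]] : ~ (\bigcap_(n in setT) (Y n @^-1` A n)) w.
      by move=> ?; apply: wA; rewrite inE.
    by rewrite (bigD1 n)//= hAE indicE memNset ?mul0r.
  rewrite indepY//; under eq_bigr do rewrite Ye.
  by rewrite -prodEFin.
pose g w := \prod_(k < N | k != i) h k (Y k w).
pose c := \prod_(k < N | k != i) e k.
have e0 n : 0 <= e n.
  by rewrite -lee_fin -he; apply: integral_ge0 => w _; rewrite lee_fin.
have c0 : 0 <= c by apply: prodr_ge0.
have mg : measurable_fun setT g.
  rewrite /g; under eq_fun do rewrite -big_filter.
  by apply: measurable_prod => n _; exact: measurableT_comp.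
pose law := [the measure _ _ of pushforward P (Y i)].
(* This is the measure obtained by letting the factor at [i] vary; that it has the required form on
   a set [A] is the induction hypothesis with [\1_A] at [i]. *)
pose kappa := mscale (NngNum c0) (law (mY i)).
under eq_integral => w _ do rewrite (bigD1 i)//= -/(g w).
rewrite -(@integral_change_of_density _ _ _ _ _ P kappa (Y i) g (h i))//.
- rewrite ge0_integral_mscale//=.
  + rewrite ge0_integral_pushforward//= ?preimage_setT.
    * by rewrite he -EFinM (bigD1 i)//= mulrC.
    * exact/measurable_EFinP.
    * by move=> x _; rewrite lee_fin.
  + exact/measurable_EFinP.
  + by move=> x _; rewrite lee_fin.
- by move=> w; apply: prodr_ge0.
move=> A mA.
pose h' k := if k == i then \1_A else h k.
pose e' k := if k == i then fine (P (Y i @^-1` A)) else e k.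
have mYA : measurable (Y i @^-1` A) by rewrite -[X in measurable X]setTI; exact: mY.
have PE : P (Y i @^-1` A) = (fine (P (Y i @^-1` A)))%:E.
  by rewrite fineK// fin_num_measure.
have cE : c = \prod_(k < N | k != i) e' k.
  by apply: eq_bigr => k /negbTE ki; rewrite /e' ki.
transitivity (\prod_(k < N) e' k)%:E.
  rewrite (bigD1 i)//= -cE {1}/e' eqxx EFinM -PE muleC.
  by rewrite /kappa/= /mscale/= /pushforward.
rewrite -(IH h' e').
- apply: eq_integral => w _; rewrite (bigD1 i)//= {1}/h' eqxx; congr (_ * _)%:E.
  by apply: eq_bigr => k /negbTE ki; rewrite /h' ki.
- by move=> n; rewrite /h'; case: ifP => // _; exact: measurable_indic.
- by move=> n x; rewrite /h'; case: ifP => // _; rewrite indicE.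
- move=> n; rewrite /h' /e'; case: eqP => [->|_]//.
  by rewrite integral_indic// setIT.
- move=> n ns; rewrite /h'; case: eqP => [_|/eqP ni]; first by exists A.
  by apply: hs; rewrite inE negb_or ni.
Qed.
End Independence.

Section Chernoff.
Context (R : realType) (d : measure_display) (T : measurableType d).
Context (P : probability T R) (N : nat) (Y : 'I_N -> T -> R).
Hypothesis mY : forall n, measurable_fun setT (Y n).
Hypothesis indepY : forall A : 'I_N -> set R, (forall n, measurable (A n)) ->
  P (\bigcap_(n in setT) (Y n @^-1` A n)) = (\prod_(n < N) P (Y n @^-1` A n))%E.

Lemma measurable_ge_sum_sqr (l t : R) :
  measurable [set w | t <= l * \sum_(n < N) Y n w ^+ 2].
Proof.
rewrite -[X in measurable X]setTI.
apply: (@measurable_fun_le _ _ _ setT (cst t)) => //.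
apply: measurable_funM => //; apply: measurable_sum => n.
exact: measurable_funX.
Qed.

(** Markov's inequality for the exponential of the sum, whose expectation factors. A positive [l]
    yields upper tails, a negative [l] lower tails. *)
Lemma chernoff_sum_sqr (l e t : R) :
  (forall n, \int[P]_w (expR (l * Y n w ^+ 2))%:E = e%:E)%E ->
  (P [set w | (t <= l * \sum_(n < N) Y n w ^+ 2)%R] <= (e ^+ N * expR (- t))%:E)%E.
Proof.
move=> he.
have := @expectation_prod_independent _ _ _ P N Y mY indepY
  (fun n x => expR (l * x ^+ 2)) (fun=> e).
rewrite prodr_const card_ord => /(_ _ _ he) prodE.
have mexp : measurable_fun setT (fun x : R => expR (l * x ^+ 2)).
  by apply: measurableT_comp => //; apply: measurable_funM => //; apply: measurable_funX.
set E := [set w | _].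
have mE : measurable E by exact: measurable_ge_sum_sqr.
rewrite EFinM -prodE; [|by []|by move=> n x; exact: expR_ge0].
rewrite -[X in P X]setIT -integral_indic// [leRHS]muleC -ge0_integralZl_EFin//.
- apply: ge0_le_integral => //.
  + by apply/measurable_EFinP.
  + apply/measurable_EFinP; apply: measurable_funM => //.
    by apply: measurable_prod => n _; exact: (measurableT_comp mexp).
  + move=> w _; rewrite -EFinM lee_fin indicE -expR_sum -mulr_sumr -expRD.
    have [/set_mem wE|_] := boolP (w \in E); last exact: expR_ge0.
    by rewrite /= -expR0 ler_expR addrC subr_ge0.
- by move=> w _; rewrite lee_fin; apply: prodr_ge0 => n _; exact: expR_ge0.
- apply/measurable_EFinP.
  by apply: measurable_prod => n _; exact: (measurableT_comp mexp).
Qed.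
End Chernoff.

(** * Tail bounds for one affine form of the samples *)

Section GaussianSample.
Context (R : realType) (disp : measure_display) (T : measurableType disp).
Context (P : probability T R) (d : nat).

Lemma borel_preimage (f : 'cV[R]_d -> R) (A : set R) :
  continuous f -> measurable A -> borel (f @^-1` A).
Proof.
move=> cf mA.
have mf : measurable_fun [set: g_sigma_algebraType (@open 'cV[R]_d)] f.
  apply: (measurability _ (RGenOInfty.measurableE R)) => _ [_ [x ->] <-].
  rewrite setTI; apply: sub_sigma_algebra.
  by apply: open_comp => //; exact: open_gt.
by have := mf measurableT _ mA; rewrite setTI.
Qed.

Lemma continuous_linear_form (u : 'cV[R]_d) :
  continuous (fun x : 'cV[R]_d => (u^T *m x) 0 0).
Proof.
suff H s : continuous (fun x : 'cV[R]_d => \sum_(i <- s) u^T 0 i * x i 0).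
  by under eq_fun do rewrite mxE; exact: H.
elim: s => [|i s IH] x.
  rewrite (_ : (fun _ => _) = cst 0); first exact: cst_continuous.
  by apply/funext => y; rewrite big_nil.
rewrite (_ : (fun _ => _) = (fun y : 'cV[R]_d => u^T 0 i * y i 0)
  \+ (fun y : 'cV[R]_d => \sum_(j <- s) u^T 0 j * y j 0)); last first.
  by apply/funext => y; rewrite big_cons.
apply: continuousD; last exact: IH.
by apply: continuousM; [exact: cst_continuous|exact: coord_continuous].
Qed.
End GaussianSample.

Section GaussianTails.
Context (R : realType) (disp : measure_display) (T : measurableType disp).
Context (P : probability T R) (d : nat) (mu : 'cV[R]_d) (Sigma : 'M[R]_d).
Context (N : nat) (X : 'I_N -> T -> 'cV[R]_d).
Hypothesis iidX : iid_gaussian P mu Sigma X.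
Hypothesis Sigma_pos : posdef Sigma.
Implicit Types (c l : R) (u : 'cV[R]_d).

(** The product [v.y] with [v = (c, u)] and [y = (1, x)]. *)
Definition affine_form c u (x : 'cV[R]_d) : R := c + (u^T *m x) 0 0.

(* The mean of [affine_form c u x ^+ 2] under N(mu, Sigma). *)
Definition second_moment c u : R :=
  affine_form c u mu ^+ 2 + (u^T *m Sigma *m u) 0 0.

Lemma variance_ge0 u : 0 <= (u^T *m Sigma *m u) 0 0.
Proof.
have [->|u0] := eqVneq u 0; first by rewrite mulmx0 mxE.
by have [_ /(_ u u0)/ltW] := Sigma_pos.
Qed.

Lemma continuous_affine_form c u : continuous (affine_form c u).
Proof.
move=> x; apply: (@continuousD _ R^o); first exact: cst_continuous.
exact: continuous_linear_form.
Qed.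

Lemma measurable_affine_form c u n :
  measurable_fun setT (affine_form c u \o X n).
Proof.
move=> _ A mA; rewrite setTI comp_preimage; have [/(_ n)[+ _] _] := iidX.
by apply; apply: borel_preimage => //; exact: continuous_affine_form.
Qed.

Lemma independent_affine_form c u (A : 'I_N -> set R) :
  (forall n, measurable (A n)) ->
  P (\bigcap_(n in setT) ((affine_form c u \o X n) @^-1` A n)) =
  (\prod_(n < N) P ((affine_form c u \o X n) @^-1` A n))%E.
Proof.
move=> mA; have [_] := iidX; move=> /(_ (fun n => affine_form c u @^-1` A n)).
by apply=> n; apply: borel_preimage => //; exact: continuous_affine_form.
Qed.

(** The exact value is left existential because it has two origins: for [u = 0] the form is the
    constant [c] and no normal law is available, otherwise the Gaussian integral gives it. The upper
    bound is common to both. *)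
Lemma affine_form_mgf c u l : 2 * l * (u^T *m Sigma *m u) 0 0 < 1 ->
  exists e : R, [/\ 0 <= e,
    forall n, (\int[P]_w (expR (l * affine_form c u (X n w) ^+ 2))%:E = e%:E)%E
  & e <= expR (l * second_moment c u / (1 - 2 * l * (u^T *m Sigma *m u) 0 0))].
Proof.
move=> ls; have [u0|u0] := eqVneq u 0.
  have EE x : affine_form c u x = c by rewrite /affine_form u0 trmx0 mul0mx mxE addr0.
  exists (expR (l * c ^+ 2)); split=> [|n|]; first exact: expR_ge0.
    under eq_integral do rewrite EE.
    by rewrite integral_cst// [X in (_ * X)%E](@probability_setT _ _ _ P) mule1.
  by rewrite /second_moment EE u0 mulmx0 mxE !(mulr0, subr0, addr0) divr1.
set s := Num.sqrt ((u^T *m Sigma *m u) 0 0).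
have s2 : s ^+ 2 = (u^T *m Sigma *m u) 0 0 by rewrite sqr_sqrtr// variance_ge0.
have s0 : s != 0.
  by rewrite gt_eqF// sqrtr_gt0; have [_ /(_ u u0)] := Sigma_pos.
rewrite /second_moment -s2; rewrite -s2 in ls.
eexists; split; last exact: gaussian_mgf_bound.
  by rewrite mulr_ge0 ?expR_ge0// invr_ge0 sqrtr_ge0.
move=> n; rewrite -normal_prob_expR_sqr//.
have [/(_ n)[_ /(_ u u0) lawX] _] := iidX.
pose Y : T -> measurableTypeR R := affine_form 0 u \o X n.
have mY : measurable_fun setT Y := measurable_affine_form 0 u n.
pose law := [the measure _ _ of pushforward P Y].
transitivity (\int[law mY]_x (expR (l * (c + x) ^+ 2))%:E)%E; last first.
  apply: eq_measure_integral => A mA _; rewrite -[RHS]lawX//; congr (P _).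
  by apply/seteqP; split=> w; rewrite /= /Y /= /affine_form add0r.
rewrite ge0_integral_pushforward//.
- by apply: eq_integral => w _; rewrite /= /Y /= /affine_form add0r.
- apply/measurable_EFinP; apply: measurableT_comp => //; apply: measurable_funM => //.
  by apply: measurable_funX; apply: measurable_funD.
Qed.

Lemma second_moment_upper_tail c u : 0 < second_moment c u ->
  (P [set w | (2 * second_moment c u * N%:R <=
     \sum_(n < N) affine_form c u (X n w) ^+ 2)%R] <= (expR (- (N%:R / 12)))%:E)%E.
Proof.
set V := second_moment c u => V0; set s2 := (u^T *m Sigma *m u) 0 0.
have s20 : 0 <= s2 by exact: variance_ge0.
have sV : s2 <= V by rewrite lerDr sqr_ge0.
(* The denominator in the moment bound is then at least 3/4, so each factor is at most [exp (1/6)],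
   while the threshold contributes [exp (- N / 4)]; 1/6 - 1/4 = -1/12. *)
pose l := 1 / (8 * V).
have ls : 2 * l * s2 <= 1 / 4.
  rewrite /l; have -> : 2 * (1 / (8 * V)) * s2 = 1 / 4 * (s2 / V) by field; rewrite gt_eqF.
  by rewrite ler_piMr// ler_pdivrMr// mul1r.
have [|e [e0 eE ele]] := @affine_form_mgf c u l.
  by rewrite (le_lt_trans ls)//; lra.
have {}ele : e <= expR (1 / 6).
  apply: (le_trans ele); rewrite ler_expR -/V -/s2 ler_pdivrMr; last lra.
  have -> : l * V = 1 / 8 by rewrite /l; field; rewrite gt_eqF.
  lra.
have -> : [set w | 2 * V * N%:R <= \sum_(n < N) affine_form c u (X n w) ^+ 2] =
    [set w | N%:R / 4 <= l * \sum_(n < N) affine_form c u (X n w) ^+ 2].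
  apply: eq_set => w; congr is_true.
  rewrite /l mul1r [(8 * V)^-1 * _]mulrC ler_pdivlMr ?mulr_gt0//.
  by congr (_ <= _); field.
apply: le_trans; first exact: (@chernoff_sum_sqr _ _ _ P N (fun n => affine_form c u \o X n)
  (measurable_affine_form c u) (independent_affine_form c u) l e (N%:R / 4) eE).
rewrite lee_fin.
rewrite (@le_trans _ _ (expR (1 / 6) ^+ N * expR (- (N%:R / 4))))//.
  by rewrite ler_wpM2r ?expR_ge0// lerXn2r ?nnegrE ?expR_ge0.
rewrite -expRM_natl -expRD ler_expR; lra.
Qed.

Lemma second_moment_lower_tail c u : 0 < second_moment c u ->
  (P [set w | (\sum_(n < N) affine_form c u (X n w) ^+ 2 <=
     second_moment c u / 4 * N%:R)%R] <= (expR (- (N%:R / 12)))%:E)%E.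
Proof.
set V := second_moment c u => V0; set s2 := (u^T *m Sigma *m u) 0 0.
have s20 : 0 <= s2 by exact: variance_ge0.
have sV : s2 <= V by rewrite lerDr sqr_ge0.
(* Now the denominator is [1 + s2 / V <= 2], so each factor is at most [exp (- 1/4)], against
   [exp (N / 8)] from the threshold. The resulting rate 1/8 is relaxed to 1/12 to match the upper
   tail. *)
pose l := - (1 / (2 * V)).
have lsE : 2 * l * s2 = - (s2 / V) by rewrite /l; field; rewrite gt_eqF.
have sV1 : s2 / V <= 1 by rewrite ler_pdivrMr// mul1r.
have sV0 : 0 <= s2 / V by rewrite divr_ge0// ltW.
have [|e [e0 eE ele]] := @affine_form_mgf c u l; first by rewrite lsE; lra.
have {}ele : e <= expR (- (1 / 4)).
  apply: (le_trans ele); rewrite ler_expR -/V -/s2 ler_pdivrMr lsE; last lra.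
  have -> : l * V = - (1 / 2) by rewrite /l; field; rewrite gt_eqF.
  lra.
have -> : [set w | \sum_(n < N) affine_form c u (X n w) ^+ 2 <= V / 4 * N%:R] =
    [set w | - (N%:R / 8) <= l * \sum_(n < N) affine_form c u (X n w) ^+ 2].
  apply: eq_set => w; congr is_true.
  rewrite /l mulNr lerN2 mul1r [(2 * V)^-1 * _]mulrC ler_pdivrMr ?mulr_gt0//.
  by congr (_ <= _); field.
apply: le_trans; first exact: (@chernoff_sum_sqr _ _ _ P N (fun n => affine_form c u \o X n)
  (measurable_affine_form c u) (independent_affine_form c u) l e (- (N%:R / 8)) eE).
rewrite lee_fin opprK.
rewrite (@le_trans _ _ (expR (- (1 / 4)) ^+ N * expR (N%:R / 8)))//.
  by rewrite ler_wpM2r ?expR_ge0// lerXn2r ?nnegrE ?expR_ge0.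
rewrite -expRM_natl -expRD ler_expR.
have : (0 : R) <= N%:R by []; lra.
Qed.
End GaussianTails.

(** * The Euclidean scalar product *)

Section Dot.
Context (R : realType).
Implicit Types (m : nat).

Definition dot m (u v : 'cV[R]_m) : R := (u^T *m v) 0 0.

Lemma dotE m (u v : 'cV[R]_m) : dot u v = \sum_i u i 0 * v i 0.
Proof. by rewrite /dot mxE; apply: eq_bigr => i _; rewrite mxE. Qed.

Lemma dotC m (u v : 'cV[R]_m) : dot u v = dot v u.
Proof. by rewrite !dotE; apply: eq_bigr => i _; rewrite mulrC. Qed.

Lemma dotDr m (u v w : 'cV[R]_m) : dot u (v + w) = dot u v + dot u w.
Proof. by rewrite /dot mulmxDr mxE. Qed.

Lemma dotDl m (u v w : 'cV[R]_m) : dot (v + w) u = dot v u + dot w u.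
Proof. by rewrite dotC dotDr !(dotC u). Qed.

Lemma dotZr m (u v : 'cV[R]_m) c : dot u (c *: v) = c * dot u v.
Proof. by rewrite /dot -scalemxAr mxE. Qed.

Lemma dotZl m (u v : 'cV[R]_m) c : dot (c *: u) v = c * dot u v.
Proof. by rewrite dotC dotZr dotC. Qed.

Lemma dotNr m (u v : 'cV[R]_m) : dot u (- v) = - dot u v.
Proof. by rewrite -scaleN1r dotZr mulN1r. Qed.

Lemma dot_ge0 m (u : 'cV[R]_m) : 0 <= dot u u.
Proof. by rewrite dotE; apply: sumr_ge0 => i _; rewrite -expr2 sqr_ge0. Qed.

Lemma dot_eq0 m (u : 'cV[R]_m) : (dot u u == 0) = (u == 0).
Proof.
apply/eqP/eqP => [|->]; last by rewrite /dot mulmx0 mxE.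
rewrite dotE => /eqP; rewrite psumr_eq0; last by move=> i _; rewrite -expr2 sqr_ge0.
move=> /allP u0; apply/matrixP => i j; rewrite ord1 mxE.
by have /u0 := mem_index_enum i; rewrite /= mulf_eq0 orbb => /eqP.
Qed.

Lemma dot_gt0 m (u : 'cV[R]_m) : u != 0 -> 0 < dot u u.
Proof. by move=> u0; rewrite lt_neqAle dot_ge0 eq_sym dot_eq0 u0. Qed.

Lemma enorm_sqr m (u : 'cV[R]_m) : enorm u ^+ 2 = dot u u.
Proof.
rewrite /enorm sqr_sqrtr ?dotE; first by apply: eq_bigr => i _; rewrite expr2.
by apply: sumr_ge0 => i _; exact: sqr_ge0.
Qed.

Lemma dot_cauchy_schwarz m (u v : 'cV[R]_m) : dot u v ^+ 2 <= dot u u * dot v v.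
Proof.
have [->|u0] := eqVneq u 0.
  by rewrite dotC /dot !mulmx0 mxE expr0n /= mul0r.
have uu := dot_gt0 u0.
have := dot_ge0 (dot u u *: v + (- dot u v) *: u).
rewrite dotDl !dotDr !dotZl !dotZr (dotC v u) => H.
rewrite -(ler_pM2l uu) -subr_ge0; nra.
Qed.

End Dot.

(** * A net of the unit ball, and quadratic forms controlled on it *)

Section Net.
Context (R : realType) (m : nat).
Local Notation K := 10%N.

(* Integer vectors, coordinatewise a sign and an absolute value; those of l1-norm
   at most [K * m], scaled by [1 / (K * sqrt m)], are a [1/K]-net of the unit
   ball. *)
Definition net_index : finType := {ffun 'I_m -> bool * 'I_(K * m).+1}.

Definition net_vector (f : net_index) : 'cV[R]_m :=
  \col_i ((-1) ^+ (f i).1 * (f i).2%:R).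

Definition net : {set net_index} :=
  [set f : net_index | (\sum_i (f i).2 <= K * m)%N].

Lemma sum_half_powers n : \sum_(k < n) (2^-1 : R) ^+ k <= 2.
Proof.
suff -> : \sum_(k < n) (2^-1 : R) ^+ k = 2 - 2 * 2^-1 ^+ n.
  by rewrite gerBl mulr_ge0// exprn_ge0.
elim: n => [|n IH]; first by rewrite big_ord0; lra.
rewrite big_ord_recr /= IH exprS; lra.
Qed.

(* The weights [\prod_i 2 ^ (K - |z_i|)] are at least 1 on the net, and their sum
   over all indices factors over the coordinates. *)
Lemma card_net : #|net|%:R <= (2 ^+ (12 * m) : R).
Proof.
pose w (p : bool * 'I_(K * m).+1) : R := 2 ^+ K * 2^-1 ^+ p.2.
have w0 p : 0 <= w p by rewrite mulr_ge0 ?exprn_ge0.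
have wE (f : net_index) : \prod_i w (f i) = 2 ^+ (K * m) * 2^-1 ^+ (\sum_i (f i).2).
  by rewrite big_split /= prodr_const card_ord -exprM expr_sum.
apply: (@le_trans _ _ (\sum_(f : net_index) \prod_i w (f i))).
  rewrite -sum1_card natr_sum big_mkcond /= ler_sum// => f _.
  case: ifPn => [|_]; last by apply: prodr_ge0.
  rewrite inE wE => fK.
  by rewrite exprVn ler_pdivlMr ?exprn_gt0// mul1r ler_weXn2l// ler1n.
rewrite -(bigA_distr_bigA (fun _ => w)) /= prodr_const card_ord exprM.
apply: lerXn2r; rewrite ?nnegrE ?exprn_ge0 ?sumr_ge0//.
rewrite -(pair_bigA _ (fun b k => w (b, k))) /= /w big_bool /=.
rewrite -mulr_sumr.
have := sum_half_powers (K * m).+1.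
(* For each coordinate, two signs times a geometric sum at most 2 give the factor 4. *)
have -> : (2 : R) ^+ 12 = 2 ^+ K * 4 by rewrite !exprS expr0; lra.
have : (0 : R) < 2 ^+ K by rewrite exprn_gt0.
nra.
Qed.

(** Each [h * w i] with [h = 10 sqrt m] is rounded towards zero. Rounding this way does not lengthen
    the vector, and an error at most [1 / h] per coordinate adds up to [m / h^2 = 1/100]. The l1
    bound is the inequality of the means: [10 sqrt m |w i| <= 5 (m (w i)^2 + 1)], which sums to at
    most [10 m]. *)
Lemma net_approximation (w : 'cV[R]_m) : (0 < m)%N -> dot w w <= 1 ->
  exists2 f, f \in net &
    let u := (K%:R * Num.sqrt m%:R)^-1 *: net_vector f in
    dot u u <= 1 /\ dot (w - u) (w - u) <= 1 / 100.
Proof.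
move=> m0 w1; set h := (K%:R * Num.sqrt m%:R : R).
have mR : (0 : R) < m%:R by rewrite ltr0n.
have h0 : 0 < h by rewrite mulr_gt0// sqrtr_gt0.
have h2 : h ^+ 2 = 100 * m%:R by rewrite exprMn sqr_sqrtr ?ltW// -natrX.
pose n i := Num.trunc (h * `|w i 0|).
have hw0 i : 0 <= h * `|w i 0| by rewrite mulr_ge0// ltW.
have n_le i : (n i)%:R <= h * `|w i 0| by rewrite truncn_le.
have n_gt i : h * `|w i 0| < (n i)%:R + 1.
  by rewrite natr1 real_truncnS_gt// ger0_real.
have sum_n : (\sum_i n i <= K * m)%N.
  rewrite -(ler_nat R) natr_sum natrM.
  apply: (@le_trans _ _ (\sum_i (5 * (m%:R * (w i 0 * w i 0)) + 5))).
    apply: ler_sum => i _; apply: (le_trans (n_le i)).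
    have : 0 <= (Num.sqrt m%:R * `|w i 0| - 1) ^+ 2 by exact: sqr_ge0.
    have -> : (Num.sqrt m%:R * `|w i 0| - 1) ^+ 2 =
        m%:R * (w i 0 * w i 0) + 1 - 2 * (Num.sqrt m%:R * `|w i 0|).
      rewrite -[X in X * (_ * _)](@sqr_sqrtr _ m%:R) ?ltW//.
      by rewrite -[w i 0 * w i 0]expr2 -(real_normK (num_real (w i 0))); ring.
    by rewrite /h; lra.
  rewrite big_split /= -!mulr_sumr -dotE sumr_const card_ord -mulr_natr.
  nra.
have n_lt i : (n i < (K * m).+1)%N.
  by rewrite ltnS (leq_trans _ sum_n)// (bigD1 i)//= leq_addr.
pose f : net_index := [ffun i => (w i 0 < 0, inord (n i))].
have fE i : net_vector f i 0 = (-1) ^+ (w i 0 < 0)%R * (n i)%:R.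
  by rewrite mxE ffunE /= inordK.
exists f.
  by rewrite inE (eq_bigr n)// => i _; rewrite ffunE /= inordK.
split.
  apply: le_trans w1; rewrite !dotE; apply: ler_sum => i _.
  rewrite mxE fE -!expr2 exprMn exprVn [(_ * (n i)%:R) ^+ 2]exprMn sqrr_sign mul1r.
  rewrite ler_pdivrMl ?exprn_gt0// -(real_normK (num_real (w i 0))) -exprMn.
  by rewrite lerXn2r ?nnegrE.
rewrite dotE; apply: (@le_trans _ _ (\sum_(i < m) (h ^+ 2)^-1)).
  apply: ler_sum => i _; rewrite -expr2 mxE [in X in _ + X]mxE mxE fE.
  rewrite {1}(realEsign (num_real (w i 0))) mulrCA -mulrBr exprMn sqrr_sign mul1r.
  have -> : `|w i 0| - h^-1 * (n i)%:R = h^-1 * (h * `|w i 0| - (n i)%:R).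
    by field; rewrite gt_eqF.
  rewrite exprMn exprVn ler_piMr ?invr_ge0 ?exprn_ge0 ?ltW//.
  have := n_gt i; have := n_le i; nra.
rewrite sumr_const card_ord h2 -[leLHS]mulr_natr.
by rewrite invfM mulfVK ?gt_eqF// mul1r.
Qed.

Section Sandwich.
Variables (N : nat) (a : 'I_N -> 'cV[R]_m).

Definition mean_square (v : 'cV[R]_m) : R := N%:R^-1 * \sum_n dot (a n) v ^+ 2.

Lemma mean_square_ge0 v : 0 <= mean_square v.
Proof. by rewrite mulr_ge0 ?invr_ge0// sumr_ge0// => n _; exact: sqr_ge0. Qed.

Lemma mean_squareZ c v : mean_square (c *: v) = c ^+ 2 * mean_square v.
Proof.
rewrite /mean_square mulrCA [in RHS]mulr_sumr; congr (_ * _).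
by apply: eq_bigr => n _; rewrite dotZr exprMn.
Qed.

Lemma mean_squareD t u v : 0 < t ->
  mean_square (u + v) <= (1 + t) * mean_square u + (1 + t^-1) * mean_square v.
Proof.
move=> t0; rewrite /mean_square [(1 + t) * _]mulrCA [(1 + t^-1) * _]mulrCA -mulrDr.
rewrite ler_wpM2l ?invr_ge0// !mulr_sumr -big_split /= ler_sum// => n _.
rewrite dotDr; set x := dot _ u; set y := dot _ v.
have -> : (1 + t) * x ^+ 2 + (1 + t^-1) * y ^+ 2 =
    (x + y) ^+ 2 + t^-1 * (t * x - y) ^+ 2 by field; rewrite gt_eqF.
by rewrite lerDl mulr_ge0 ?invr_ge0 ?sqr_ge0// ltW.
Qed.

Lemma mean_square_bounded v : dot v v <= 1 ->
  mean_square v <= N%:R^-1 * \sum_n dot (a n) (a n).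
Proof.
move=> v1; rewrite ler_wpM2l ?invr_ge0// ler_sum// => n _.
apply: (le_trans (dot_cauchy_schwarz _ _)).
by rewrite ler_piMr// dot_ge0.
Qed.

Lemma dotDD t (u v : 'cV[R]_m) : 0 < t ->
  dot (u + v) (u + v) <= (1 + t) * dot u u + (1 + t^-1) * dot v v.
Proof.
move=> t0; have := dot_ge0 (t *: u - v); rewrite -scaleN1r.
rewrite !dotDl !dotDr !dotZl !dotZr (dotC v u) => H.
have -> : (1 + t) * dot u u + (1 + t^-1) * dot v v =
  dot u u + dot u v + (dot u v + dot v v) +
  t^-1 * (t * (t * dot u u) + t * (-1 * dot u v) + (-1 * (t * dot u v) + -1 * (-1 * dot v v))).
  by field; rewrite gt_eqF.
by rewrite lerDl mulr_ge0 ?invr_ge0// ltW.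
Qed.

(* With the optimal constant [Q] in [mean_square w <= Q * dot w w], splitting
   [w = u + (w - u)] with [u] in the net and [|w - u| <= 1/10] gives
   [Q <= 20/9 + Q/10]. *)
Lemma mean_square_net_bounds : (0 < m)%N ->
  (forall f, f \in net -> net_vector f != 0 ->
    dot (net_vector f) (net_vector f) / 4 <= mean_square (net_vector f)
      <= 2 * dot (net_vector f) (net_vector f)) ->
  forall w, dot w w / 16 <= mean_square w <= 5 / 2 * dot w w.
Proof.
move=> m0 hf.
have {}hf c f : f \in net -> let u := c *: net_vector f in
    dot u u / 4 <= mean_square u <= 2 * dot u u.
  move=> fn /=; rewrite mean_squareZ dotZl dotZr.
  have [->|f0] := eqVneq (net_vector f) 0.
    rewrite -(scale0r (0 : 'cV_m)) mean_squareZ dotZl expr0n /=; apply/andP; lra.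
  have /andP[] := hf f fn f0; have := sqr_ge0 c.
  rewrite expr2 => c2 h1 h2; apply/andP; split; nra.
have homog (w : 'cV[R]_m) : w != 0 ->
    exists c, [/\ 0 < c, dot (c *: w) (c *: w) = 1 & c ^+ 2 * dot w w = 1].
  move=> /dot_gt0 w0; exists (Num.sqrt (dot w w))^-1.
  have E : (Num.sqrt (dot w w))^-1 ^+ 2 * dot w w = 1.
    by rewrite exprVn sqr_sqrtr ?ltW// mulVf// gt_eqF.
  split=> //; first by rewrite invr_gt0 sqrtr_gt0.
  by rewrite dotZl dotZr mulrA -expr2.
pose S := [set mean_square w | w in [set w | dot w w <= 1]].
have S0 : S 0.
  by exists 0; rewrite /= ?/dot ?mulmx0 ?mxE// -(scale0r 0) mean_squareZ expr0n /= mul0r.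
have Sub : has_ubound S.
  by exists (N%:R^-1 * \sum_n dot (a n) (a n)) => _ [w w1 <-]; exact: mean_square_bounded.
(* The crude bound by Cauchy-Schwarz makes [Q] finite, without which the term [Q / 10] could not be
   absorbed. *)
pose Q := sup S.
have leQ w : mean_square w <= Q * dot w w.
  have [->|w0] := eqVneq w 0.
    by rewrite -(scale0r 0) mean_squareZ dotZl expr0n /= !mul0r mulr0.
  have [c [c0 cw1 cE]] := homog w w0.
  have : mean_square (c *: w) <= Q by apply: ub_le_sup => //; exists (c *: w) => //=; rewrite cw1.
  rewrite mean_squareZ => H.
  by rewrite -(ler_pM2l (exprn_gt0 2 c0)) [leRHS]mulrCA cE mulr1.
have Q0 : 0 <= Q by exact: ub_le_sup.
have Qle : Q <= 20 / 9 + Q / 10.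
  apply: ge_sup; first by exists 0.
  move=> _ [v v1 <-]; rewrite /= in v1.
  have [f fn [u1 vu]] := net_approximation m0 v1.
  set u := (_ *: _) in u1 vu.
  have /andP[_ Hu] := hf (K%:R * Num.sqrt m%:R)^-1 f fn; rewrite -/u in Hu.
  (* The weights become 10/9 and 10: the net part costs 2 * 10/9 and the remainder
     [10 * Q / 100]. *)
  have t9 : (0 : R) < 1 / 9 by lra.
  have := mean_squareD u (v - u) t9; rewrite subrKC.
  have -> : (1 / 9 : R)^-1 = 9 by field.
  have := leQ (v - u); nra.
have Q52 : Q <= 5 / 2 by lra.
move=> w; apply/andP; split; last first.
  by apply: (le_trans (leQ w)); rewrite ler_wpM2r ?dot_ge0.
have [->|w0] := eqVneq w 0.
  by rewrite {1}/dot mulmx0 mxE mul0r mean_square_ge0.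
have [c [c0 cw1 cE]] := homog w w0.
rewrite -(ler_pM2l (exprn_gt0 2 c0)) mulrA cE -mean_squareZ.
have {}w1 : dot (c *: w) (c *: w) <= 1 by rewrite cw1.
move: (c *: w) cw1 w1 => {c c0 cE w0}v v1 v1'.
have [f fn [u1 vu]] := net_approximation m0 v1'.
set u := (_ *: _) in u1 vu.
have /andP[Hu _] := hf (K%:R * Num.sqrt m%:R)^-1 f fn; rewrite -/u in Hu.
have t9 : (0 : R) < 1 / 9 by lra.
(* This forces [|u|^2 >= 81/100]. Then [mean_square u <= 2 mean_square v + 2 mean_square (u - v)],
   the last mean square being at most [Q / 100 <= 1/40], leaves [81/800 - 20/800 > 1/16]. *)
have := dotDD u (v - u) t9; rewrite subrKC v1.
have -> : (1 / 9 : R)^-1 = 9 by field.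
have := mean_squareD v (u - v) (@ltr01 R); rewrite subrKC.
have -> : mean_square (u - v) = mean_square (v - u).
  by rewrite -opprB -scaleN1r mean_squareZ sqrrN expr1n mul1r.
rewrite invr1; have := leQ (v - u); have := dot_ge0 (v - u).
nra.
Qed.
End Sandwich.
End Net.

(** * Positive definite matrices, and the bounds on the second moment *)

Section PositiveDefinite.
Context (R : realType).
Implicit Types n : nat.

Lemma quadE n (A : 'M[R]_n) (v : 'cV[R]_n) : (v^T *m A *m v) 0 0 = dot v (A *m v).
Proof. by rewrite /dot mulmxA. Qed.

Lemma dot_mulmx n (A : 'M[R]_n) (u v : 'cV[R]_n) : dot u (A *m v) = dot (A^T *m u) v.
Proof. by rewrite /dot trmx_mul trmxK mulmxA. Qed.

Lemma dot_col_mx m n (u1 u2 : 'cV[R]_m) (v1 v2 : 'cV[R]_n) :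
  dot (col_mx u1 v1) (col_mx u2 v2) = dot u1 u2 + dot v1 v2.
Proof. by rewrite /dot tr_col_mx mul_row_col mxE. Qed.

Lemma dot_scalar_mx x (y : 'cV[R]_1) : dot x%:M y = x * y 0 0.
Proof. by rewrite /dot tr_scalar_mx mul_scalar_mx mxE. Qed.

Lemma posdef_unitmx n (A : 'M[R]_n) : posdef A -> A \in unitmx.
Proof.
move=> [_ A0]; rewrite unitmxE unitfE; apply/negP => /det0P[v v0 vA].
have v0' : v^T != 0 by rewrite -(inj_eq trmx_inj) trmxK trmx0.
by have := A0 v^T v0'; rewrite trmxK vA mul0mx mxE ltxx.
Qed.

(** Induction on the Schur complement of the upper left entry [a]. Its quadratic form at [v] is that
    of [A] at [(- b.v / a, v)], the minimum over the first coordinate, and so stays positive. *)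
Lemma cholesky n (A : 'M[R]_n) : posdef A -> exists L : 'M[R]_n, A = L *m L^T.
Proof.
elim: n A => [A _|n IH A [AT A0]].
  by exists 0; apply/matrixP => -[].
move: A AT A0; rewrite -[n.+1]/(1 + n)%N => A AT A0.
pose a := ulsubmx A 0 0; pose b := dlsubmx A; pose C := drsubmx A.
have ulE : ulsubmx A = a%:M by rewrite [LHS]mx11_scalar.
have urE : ursubmx A = b^T by rewrite /b trmx_dlsub AT.
have CT : C^T = C by rewrite /C trmx_drsub AT.
have AE : A = block_mx a%:M b^T b C by rewrite -[LHS]submxK ulE urE.
have quad x (v : 'cV[R]_n) : dot (col_mx x%:M v) (A *m col_mx x%:M v) =
    a * x ^+ 2 + 2 * x * dot b v + dot v (C *m v).
  rewrite AE mul_block_col dot_col_mx !dotDr -scalar_mxM dot_scalar_mx mul_mx_scalar.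
  rewrite dotZr (dotC v b) !dot_scalar_mx -/(dot b v) mxE eqxx mulr1n.
  ring.
have a0 : 0 < a.
  have := A0 (col_mx 1%:M 0); rewrite quadE quad.
  have -> : col_mx 1%:M 0 != 0 :> 'cV[R]_(1 + n).
    apply/eqP => /(congr1 (@usubmx _ 1 n 1)).
    rewrite col_mxKu linear0 => /matrixP/(_ 0 0).
    by rewrite !mxE => /eqP; rewrite oner_eq0.
  by rewrite /dot mulmx0 mxE !mulmx0 mxE; move=> /(_ isT); lra.
pose S := C - a^-1 *: (b *m b^T).
have Sv v : dot v (S *m v) = dot v (C *m v) - a^-1 * dot b v ^+ 2.
  rewrite /S mulmxBl -scalemxAl -scaleN1r dotDr dotZr dotZr -mulmxA.
  rewrite [b^T *m v]mx11_scalar mul_mx_scalar dotZr -/(dot b v) (dotC v b).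
  by rewrite mulN1r -expr2.
have [|L' SE] := IH S.
  split=> [|v v0]; first by rewrite /S linearB linearZ /= CT trmx_mul trmxK.
  rewrite quadE Sv.
  have := A0 (col_mx (- (a^-1 * dot b v))%:M v); rewrite quadE quad.
  have -> : col_mx (- (a^-1 * dot b v))%:M v != 0.
    apply: contraNneq v0 => /(congr1 (@dsubmx _ 1 n 1)).
    by rewrite col_mxKd linear0 => ->.
  move=> /(_ isT).
  congr (_ < _); field; exact: lt0r_neq0.
exists (block_mx (Num.sqrt a)%:M 0 ((Num.sqrt a)^-1 *: b) L').
have sa : Num.sqrt a != 0 by rewrite gt_eqF// sqrtr_gt0.
rewrite tr_block_mx mulmx_block AE tr_scalar_mx trmx0 !mulmx0 !mul0mx !addr0.
rewrite -scalar_mxM -expr2 sqr_sqrtr ?ltW// mul_scalar_mx mul_mx_scalar.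
rewrite linearZ /= !scalerA mulfV// !scale1r -SE /S -scalemxAl -scalemxAr scalerA.
by rewrite -invfM -expr2 sqr_sqrtr ?ltW// addrC subrK.
Qed.

Lemma frobenius_bound n (A : 'M[R]_n) : exists2 c, 0 < c &
  forall v, dot (A *m v) (A *m v) <= c ^+ 2 * dot v v.
Proof.
pose F := \sum_i dot (row i A)^T (row i A)^T.
have F0 : 0 <= F by apply: sumr_ge0 => i _; exact: dot_ge0.
(* [F] is the squared Frobenius norm; [F <= (1 + F) ^+ 2] avoids a square root and keeps the
   constant positive when [A = 0]. *)
exists (1 + F) => [|v]; first by rewrite ltr_pwDl.
apply: (@le_trans _ _ (F * dot v v)); last first.
  rewrite ler_wpM2r ?dot_ge0// -subr_ge0.
  have -> : (1 + F) ^+ 2 - F = 1 + F + F ^+ 2 by ring.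
  by rewrite addr_ge0 ?sqr_ge0// addr_ge0.
rewrite [leLHS]dotE mulr_suml ler_sum// => i _; rewrite -expr2.
have -> : (A *m v) i 0 = dot (row i A)^T v.
  by rewrite /dot trmxK -row_mul [RHS]mxE.
exact: dot_cauchy_schwarz.
Qed.

Lemma frobenius_quad_bound n (A : 'M[R]_n) : exists2 c, 0 < c &
  forall v, dot v (A *m v) <= c * dot v v.
Proof.
have [c c0 cA] := frobenius_bound A; exists c => // v.
apply: le_trans (ler_norm _) _.
rewrite -ler_sqr ?nnegrE ?mulr_ge0 ?dot_ge0 ?(ltW c0)//.
rewrite real_normK ?num_real//; apply: le_trans (dot_cauchy_schwarz _ _) _.
by have := cA v; have := dot_ge0 v; nra.
Qed.

Lemma enormE n (v : 'cV[R]_n) : enorm v = Num.sqrt (dot v v).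
Proof. by rewrite -enorm_sqr sqrtr_sqr ger0_norm// sqrtr_ge0. Qed.

(** A [sup] dominates its set only if the set is bounded above, which the Frobenius bound
    provides. *)
Lemma enorm_le_opnorm2 n (A : 'M[R]_n) v :
  dot v v <= 1 -> enorm (A *m v) <= opnorm2 A.
Proof.
move=> v1; apply: ub_le_sup; last first.
  by exists v => //=; rewrite enormE -sqrtr1 ler_wsqrtr.
have [c c0 cA] := frobenius_bound A.
exists c => _ [x /= x1 <-].
have xx : dot x x <= 1 by rewrite -enorm_sqr exprn_ile1// sqrtr_ge0.
rewrite -ler_sqr ?nnegrE ?sqrtr_ge0 ?(ltW c0)// enorm_sqr.
apply: le_trans (cA x) _; by rewrite ler_piMr// sqr_ge0.
Qed.

Lemma opnorm2_ge0 n (A : 'M[R]_n) : 0 <= opnorm2 A.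
Proof.
apply: le_trans (@enorm_le_opnorm2 _ A 0 _); first exact: sqrtr_ge0.
by rewrite /dot mulmx0 mxE.
Qed.

Lemma posdef_opnorm2 n (A : 'M[R]_n) v : dot v (A *m v) <= opnorm2 A * dot v v.
Proof.
have [->|v0] := eqVneq v 0; first by rewrite /dot !mulmx0 mxE mulr0.
have vv := dot_gt0 v0; set r := Num.sqrt (dot v v).
have r0 : 0 < r by rewrite sqrtr_gt0.
have r2 : r ^+ 2 = dot v v by rewrite sqr_sqrtr ?ltW.
pose w := r^-1 *: v.
have ww : dot w w = 1 by rewrite dotZl dotZr mulrA -expr2 exprVn r2 mulVf ?gt_eqF.
have vE : v = r *: w by rewrite scalerA mulfV ?scale1r ?gt_eqF.
have -> : dot v (A *m v) = r ^+ 2 * dot w (A *m w).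
  by rewrite vE -scalemxAr dotZl dotZr mulrA.
rewrite r2 mulrC ler_wpM2r ?(ltW vv)//.
have wA : enorm (A *m w) <= opnorm2 A by apply: enorm_le_opnorm2; rewrite ww.
apply: le_trans wA.
apply: le_trans (ler_norm _) _; rewrite -ler_sqr ?nnegrE ?sqrtr_ge0//.
rewrite real_normK ?num_real//; apply: le_trans (dot_cauchy_schwarz _ _) _.
by rewrite ww mul1r enorm_sqr.
Qed.

Lemma smallest_eigenvalue_gt0 n (A : 'M[R]_n) s :
  posdef A -> smallest_eigenvalue A s -> 0 < s.
Proof.
move=> [_ A0] [/eigenvalueP[v vA v0] _].
have v0' : v^T != 0 by rewrite -(inj_eq trmx_inj) trmxK trmx0.
have := A0 v^T v0'; rewrite trmxK vA -scalemxAl mxE => H.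
have := dot_gt0 v0'; rewrite /dot trmxK => vv.
by rewrite -(pmulr_lgt0 _ vv).
Qed.

(* If [B = A - s] is invertible, [s] being the infimum of the Rayleigh quotient,
   then testing [B >= 0] on [x - B^-1 x / c] bounds the quotient away from [s];
   hence [s] is an eigenvalue. *)
Lemma smallest_eigenvalue_rayleigh n (A : 'M[R]_n) s v :
  posdef A -> smallest_eigenvalue A s -> s * dot v v <= dot v (A *m v).
Proof.
move=> Apos sA; have [AT A0] := Apos.
have [->|v0] := eqVneq v 0; first by rewrite /dot !mulmx0 mxE mulr0.
pose S := [set dot x (A *m x) / dot x x | x in [set x | x != 0]].
have S0 : S !=set0 by exists (dot v (A *m v) / dot v v), v.
have Slb : has_lbound S.
  exists 0 => _ [x /= x0 <-]; rewrite -quadE divr_ge0 ?dot_ge0//.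
  exact/ltW/A0.
pose i := inf S.
have iA x : i * dot x x <= dot x (A *m x).
  have [->|x0] := eqVneq x 0; first by rewrite /dot !mulmx0 mxE mulr0.
  by rewrite -ler_pdivlMr ?dot_gt0//; apply: ge_inf => //; exists x.
suff eig : eigenvalue A i.
  apply: le_trans (iA v); rewrite ler_wpM2r ?dot_ge0//.
  by have [_] := sA; apply.
pose B := A - i%:M.
have BE x : B *m x = A *m x - i *: x by rewrite mulmxBl mul_scalar_mx.
have BT : B^T = B by rewrite /B linearB /= AT tr_scalar_mx.
have B0 x : 0 <= dot x (B *m x).
  by rewrite BE dotDr dotNr dotZr subr_ge0.
have : ~~ (B \in unitmx).
  apply/negP => Bu.
  have [c c0 cB] := frobenius_quad_bound (invmx B).
  suff H : i + c^-1 <= i by move: H; rewrite gerDl leNgt invr_gt0 c0.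
  apply: lb_le_inf => // _ [x /= x0 <-].
  have xx := dot_gt0 x0.
  rewrite ler_pdivlMr// mulrDl -lerBrDl.
  have -> : dot x (A *m x) - i * dot x x = dot x (B *m x).
    by rewrite BE dotDr dotNr dotZr.
  pose y := invmx B *m x.
  have By : B *m y = x by rewrite mulmxA mulmxV// mul1mx.
  have yB : dot y (B *m x) = dot x x by rewrite dot_mulmx BT By.
  (* The expansion is [x.Bx - 2 |x|^2 / c + x.y / c^2], and [x.y <= c |x|^2]; hence
     [x.Bx >= |x|^2 / c]. *)
  have := B0 (x + (- c^-1) *: y).
  rewrite mulmxDr -scalemxAr By dotDl !dotDr !dotZl !dotZr yB (dotC y).
  have := cB x; rewrite -/y => H1 H2.
  have ci : 0 < c^-1 by rewrite invr_gt0.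
  have : c^-1 * c^-1 * dot x y <= c^-1 * dot x x.
    rewrite -mulrA ler_pM2l//.
    by rewrite ler_pdivrMl.
  nra.
rewrite unitmxE unitfE negbK => /det0P[x x0 xB].
apply/eigenvalueP; exists x => //.
by apply/eqP; rewrite -subr_eq0 -mul_mx_scalar -mulmxBr xB.
Qed.

Section Lambda0.
Context (d : nat) (mu : 'cV[R]_d) (s : R).
Hypothesis s0 : 0 < s.
Local Notation lam := (lambda0 s mu).

Let p0 : 0 <= dot mu mu := dot_ge0 mu.

Let discriminant_ge0 : 0 <= (1 + s + dot mu mu) ^+ 2 - 4 * s.
Proof.
have -> : (1 + s + dot mu mu) ^+ 2 - 4 * s =
  (1 - s) ^+ 2 + dot mu mu * (2 + 2 * s + dot mu mu) by ring.
by rewrite addr_ge0 ?sqr_ge0// mulr_ge0// !addr_ge0// mulr_ge0// ltW.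
Qed.

(** This is the characteristic equation of the matrix with rows [(1, |mu|)] and
    [(|mu|, s + |mu|^2)], of trace [1 + s + |mu|^2] and determinant [s]; [lambda0] is its smaller
    eigenvalue. *)
Lemma lambda0_root : lam ^+ 2 + s = (1 + s + dot mu mu) * lam.
Proof.
rewrite /lambda0 /= enorm_sqr; set p := dot mu mu; set q := Num.sqrt _.
have : q ^+ 2 = (1 + s + p) ^+ 2 - 4 * s.
  by rewrite sqr_sqrtr.
rewrite !expr2; lra.
Qed.

Lemma lambda0_bounds : [/\ 0 < lam, lam <= 1 & lam <= s].
Proof.
rewrite /lambda0 /= enorm_sqr; set p := dot mu mu; set q := Num.sqrt _.
have pp : 0 <= p := p0.
have sp : 0 <= s * p by rewrite mulr_ge0// ltW.
have c0 : 0 < 1 + s + p by rewrite ltr_pwDl// addr_gt0.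
split.
- suff : q < 1 + s + p by lra.
  rewrite -[ltRHS]gtr0_norm// -sqrtr_sqr ltr_sqrt ?exprn_gt0//.
  by rewrite gtrBl mulr_gt0.
- suff : s + p - 1 <= q by lra.
  apply: le_trans (ler_norm _) _; rewrite -sqrtr_sqr ler_wsqrtr// !expr2; lra.
- suff : 1 + p - s <= q by lra.
  apply: le_trans (ler_norm _) _; rewrite -sqrtr_sqr ler_wsqrtr// !expr2; lra.
Qed.
End Lambda0.

Section SecondMoment.
Context (d : nat) (mu : 'cV[R]_d) (Sigma : 'M[R]_d) (s : R).
Hypotheses (Sigma_pos : posdef Sigma) (sS : smallest_eigenvalue Sigma s).

Lemma second_moment_lower c u :
  lambda0 s mu * (c ^+ 2 + dot u u) <= second_moment mu Sigma c u.
Proof.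
have s0 := smallest_eigenvalue_gt0 Sigma_pos sS.
have Su := smallest_eigenvalue_rayleigh u Sigma_pos sS.
rewrite /second_moment quadE /affine_form -/(dot u mu).
have [l0 l1 ls] := lambda0_bounds mu s0.
have := lambda0_root mu s0; have := dot_cauchy_schwarz u mu.
have := dot_ge0 u; have := dot_ge0 mu.
move: (lambda0 s mu) (dot u u) (dot mu mu) (dot u mu) (dot u (Sigma *m u)) l0 l1 ls Su.
move=> l w p t q l0 l1 ls Su p0 w0 tp lroot.
suff : 0 <= (1 - l) * c ^+ 2 + 2 * c * t + t ^+ 2 + (s - l) * w by rewrite !expr2; lra.
(* Multiplication by [1 - l] completes the square in [c], using the root equation as
   [(1 - l) (s - l) = l p]. If [l = 1], that equation forces [p = 0] and the cross term vanishes. *)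
have [l1'|l1'] := eqVneq l 1.
  have p0' : p = 0 by move: lroot; rewrite l1'; lra.
  have t0 : t = 0 by apply/eqP; rewrite -sqrf_eq0 eq_le sqr_ge0 andbT (le_trans tp)// p0' mulr0.
  by rewrite l1' t0; nra.
have l1s : 0 < 1 - l by rewrite subr_gt0 lt_neqAle l1' l1.
rewrite -(pmulr_rge0 _ l1s).
have -> : (1 - l) * ((1 - l) * c ^+ 2 + 2 * c * t + t ^+ 2 + (s - l) * w) =
  ((1 - l) * c + t) ^+ 2 + l * (p * w - t ^+ 2).
  have E : (1 - l) * (s - l) = l * p by lra.
  transitivity (((1 - l) * c + t) ^+ 2 - l * t ^+ 2 + (1 - l) * (s - l) * w).
    ring.
  rewrite E; ring.
by rewrite addr_ge0 ?sqr_ge0// mulr_ge0 ?(ltW l0)// subr_ge0 mulrC.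
Qed.

(** The squared mean is handled by Cauchy-Schwarz for [(c, u)] and [(1, mu)], written out in
    components; the variance by the operator norm. *)
Lemma second_moment_upper c u :
  second_moment mu Sigma c u <= (1 + dot mu mu + opnorm2 Sigma) * (c ^+ 2 + dot u u).
Proof.
rewrite /second_moment quadE /affine_form -/(dot u mu).
have := posdef_opnorm2 Sigma u.
have := opnorm2_ge0 Sigma.
have := dot_ge0 (u + (- c) *: mu).
rewrite dotDl !dotDr !dotZl !dotZr (dotC mu u).
have := dot_cauchy_schwarz u mu; have := sqr_ge0 c.
move: (opnorm2 Sigma) (dot u u) (dot mu mu) (dot u mu) (dot u (Sigma *m u)).
move=> o w p t q c0 cs H o0 qo; have := mulr_ge0 o0 c0.
rewrite !expr2 in c0 cs *; lra.
Qed.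
End SecondMoment.
End PositiveDefinite.

(** * Contraction of the loss under gradient descent *)

Section GradientDescent.
Context (R : realType).

Lemma derive_quadratic (V : normedModType R) (f : V -> R) (a v : V) (l q : R) :
  (forall h, f (h *: v + a) = f a + h * l + h ^+ 2 * q) -> 'D_v f a = l.
Proof.
move=> fE; apply: cvg_lim => //=.
have H : (l + h * q) @[h --> (0 : R)^'] --> l.
  rewrite -[X in _ --> X]addr0 -[X in _ --> _ + X](mul0r q).
  apply: cvgD; first exact: cvg_cst.
  apply: cvgMl; exact: nbhs_dnbhs.
apply: cvg_trans H; apply: near_eq_cvg; near=> h.
have h0 : h != 0 by near: h; exact: nbhs_dnbhs_neq.
rewrite /= fE [X in h^-1 *: X](_ : _ = h * (l + h * q)); last by ring.
by rewrite [RHS]mulKf.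
Unshelve. all: by end_near. Qed.

Lemma sum_row_mul_symmetric n m (A B : 'M[R]_(n, m)) (G : 'M[R]_m) i : G^T = G ->
  \sum_j A i j * (B *m G) i j = dot (row i A)^T (G *m (row i B)^T).
Proof.
move=> GT; rewrite dotE; apply: eq_bigr => j _; rewrite !mxE; congr (_ * _).
by apply: eq_bigr => k _; rewrite !mxE mulrC -{1}GT mxE.
Qed.

Section Contraction.
Context (m : nat) (G : 'M[R]_m) (lam Lam eta : R).
Hypotheses (GT : G^T = G) (lam0 : 0 < lam) (eta0 : 0 < eta)
  (eta_le : eta * Lam <= 5 / 6).
Hypothesis G_bounds : forall v, lam * dot v v <= dot v (G *m v) <= Lam * dot v v.

(** With [g = G v] the new value is [v.g - 4 eta g.g + 4 eta^2 g.Gg]. The upper bound on [G] makes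
    the last term at most 5/6 of the middle one, leaving [- (2/3) eta g.g]; the lower bound turns
    [g.g] into [lam v.g]. *)
Lemma gradient_step_contraction (v : 'cV[R]_m) :
  dot (v - (2 * eta) *: (G *m v)) (G *m (v - (2 * eta) *: (G *m v))) <=
  (1 - 2 / 3 * eta * lam) * dot v (G *m v).
Proof.
set g := G *m v; set v' := v - _.
have -> : dot v' (G *m v') = dot v g - 4 * eta * dot g g + 4 * eta ^+ 2 * dot g (G *m g).
  rewrite /v' -scaleNr mulmxDr -scalemxAr -/g.
  rewrite dotDl !dotDr !dotZl !dotZr (dot_mulmx G v g) GT -/g; ring.
have /andP[_ Hg] := G_bounds g; have /andP[Hv _] := G_bounds v.
have gg := dot_ge0 g.
(* Expand [0 <= |g - lam v|^2] and use [lam |v|^2 <= v.g]. *)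
have low : lam * dot v g <= dot g g.
  have := dot_ge0 (g - lam *: v); rewrite -scaleNr.
  rewrite dotDl !dotDr !dotZl !dotZr (dotC g v) => H.
  have := ler_wpM2l (ltW lam0) Hv; rewrite -/g; lra.
have : 4 * eta ^+ 2 * dot g (G *m g) <= 4 * eta * (5 / 6) * dot g g.
  have e2 : 0 <= 4 * eta ^+ 2 by rewrite mulr_ge0// exprn_ge0// ltW.
  apply: le_trans (ler_wpM2l e2 Hg) _.
  have -> : 4 * eta ^+ 2 * (Lam * dot g g) = 4 * eta * dot g g * (eta * Lam) by ring.
  have -> : 4 * eta * (5 / 6) * dot g g = 4 * eta * dot g g * (5 / 6) by ring.
  by rewrite ler_wpM2l// mulr_ge0// mulr_ge0// ltW.
have := ler_wpM2l (ltW eta0) low; lra.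
Qed.
End Contraction.

Section EmpiricalLoss.
Context (d N : nat) (gamma : R) (mu b0 : 'cV[R]_d) (Sigma B1 : 'M[R]_d).
Context (x : 'I_N -> 'cV[R]_d) (eta : R).
Local Notation L := (empirical_loss gamma mu Sigma B1 b0 x).

Definition augment (y : 'cV[R]_d) : 'cV[R]_(1 + d) := col_mx 1%:M y.

(** The minimiser subtracted here has intercept [b0 - gamma Sigma^-1 mu] and matrix
    [B1 + gamma Sigma^-1], the coefficients of [b - gamma s]. *)
Definition error_mx (theta : params R d) : 'M[R]_(d, 1 + d) :=
  row_mx (theta.1 - b0 + gamma *: (invmx Sigma *m mu))
         (theta.2 - B1 - gamma *: invmx Sigma).

Definition gram : 'M[R]_(1 + d) :=
  N%:R^-1 *: \sum_n augment (x n) *m (augment (x n))^T.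

(** The trace is split over rows because a gradient step acts on each row of [E] separately. *)
Definition quad_loss (E : 'M[R]_(d, 1 + d)) : R :=
  \sum_i dot (row i E)^T (gram *m (row i E)^T).

Lemma gram_tr : gram^T = gram.
Proof.
rewrite /gram linearZ /= linear_sum /=; congr (_ *: _).
by apply: eq_bigr => n _; rewrite trmx_mul trmxK.
Qed.

Lemma dot_gram v : dot v (gram *m v) = mean_square (fun n => augment (x n)) v.
Proof.
rewrite /gram -scalemxAl dotZr /mean_square; congr (_ * _).
rewrite mulmx_suml /dot mulmx_sumr summxE; apply: eq_bigr => n _.
rewrite -mulmxA [_^T *m v]mx11_scalar mul_mx_scalar -/(dot _ v) -scalemxAr mxE.
by rewrite -/(dot v _) (dotC v) mxE eqxx mulr1n expr2.
Qed.

Lemma residualE theta y :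
  velocity theta y - drift B1 b0 y + gamma *: score mu Sigma y =
  error_mx theta *m augment y.
Proof.
rewrite /velocity /drift /score /error_mx /augment mul_row_col mulmx1.
rewrite mulmxBl mulmxBl -scalemxAl mulmxBr scalerN scalerBr opprB.
move: (theta.2 *m y) (B1 *m y) (gamma *: (invmx Sigma *m y)) (gamma *: _).
by move=> a b c e; rewrite opprD; apply/matrixP => i j; rewrite !mxE; ring.
Qed.

Lemma empirical_lossE theta : L theta = quad_loss (error_mx theta).
Proof.
rewrite /empirical_loss /quad_loss.
under [RHS]eq_bigr do rewrite dot_gram.
rewrite /mean_square -mulr_sumr exchange_big /=; congr (_ * _).
apply: eq_bigr => n _; rewrite residualE enorm_sqr dotE.
by apply: eq_bigr => i _; rewrite -expr2 dotC /dot trmxK -row_mul [in RHS]mxE.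
Qed.

Lemma error_line theta v h :
  error_mx (h *: v + theta) = error_mx theta + h *: row_mx v.1 v.2.
Proof.
rewrite /error_mx scale_row_mx add_row_mx /=; congr row_mx.
  by apply/matrixP => i j; rewrite !mxE; ring.
by apply/matrixP => i j; rewrite !mxE; ring.
Qed.

Lemma derive_empirical_loss (theta v : 'cV[R]_d * 'M[R]_d) :
  'D_v L theta = 2 * \sum_i \sum_j row_mx v.1 v.2 i j * (error_mx theta *m gram) i j.
Proof.
set D := row_mx _ _; set E := error_mx theta.
apply: (@derive_quadratic _ _ _ _ _ (quad_loss D)) => h.
rewrite !empirical_lossE error_line -/D -/E /quad_loss !mulr_sumr -!big_split /=.
apply: eq_bigr => i _.
have -> : (row i (E + h *: D))^T = (row i E)^T + h *: (row i D)^T.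
  by apply/matrixP => a b; rewrite !mxE.
rewrite mulmxDr -scalemxAr.
rewrite dotDl !dotDr !dotZl !dotZr [dot (row i E)^T (gram *m (row i D)^T)]dot_mulmx gram_tr.
rewrite (dotC (gram *m (row i E)^T)).
rewrite (sum_row_mul_symmetric _ _ _ gram_tr).
ring.
Qed.

Lemma gradient_empirical_loss theta :
  row_mx (gradient L theta).1 (gradient L theta).2 = 2 *: (error_mx theta *m gram).
Proof.
have D (v : 'cV[R]_d * 'M[R]_d) i k : row_mx v.1 v.2 = delta_mx i k ->
    'D_v L theta = 2 * (error_mx theta *m gram) i k.
  move=> vE; rewrite derive_empirical_loss vE (bigD1 i)//= (bigD1 k)//=.
  rewrite mxE !eqxx mul1r big1 ?addr0 => [|j /negbTE jk]; last by rewrite mxE jk andbF mul0r.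
  rewrite big1 ?addr0// => i' /negbTE ii; rewrite big1// => j _.
  by rewrite mxE ii mul0r.
apply/matrixP => i k; rewrite [RHS]mxE.
case: (split_ordP k) => j ->.
  rewrite row_mxEl mxE (D _ i (lshift d j))//= {j}(ord1 j).
  apply/matrixP => a b; case: (split_ordP b) => c ->.
    by rewrite row_mxEl !mxE eq_lshift.
  by rewrite row_mxEr !mxE eq_rlshift andbF.
rewrite row_mxEr mxE (D _ i (rshift 1 j))//=.
apply/matrixP => a b; case: (split_ordP b) => c ->.
  by rewrite row_mxEl !mxE eq_lrshift andbF.
by rewrite row_mxEr !mxE eq_rshift.
Qed.

Lemma error_gd_step (theta : 'cV[R]_d * 'M[R]_d) :
  error_mx (theta - eta *: gradient L theta) =
  error_mx theta - (2 * eta) *: (error_mx theta *m gram).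
Proof.
rewrite -scaleNr addrC error_line gradient_empirical_loss scalerA mulNr.
by rewrite [eta * 2]mulrC scaleNr.
Qed.

Lemma quad_loss_gd_step (lam Lam : R) (E : 'M[R]_(d, 1 + d)) :
  0 < lam -> 0 < eta -> eta * Lam <= 5 / 6 ->
  (forall v, lam * dot v v <= dot v (gram *m v) <= Lam * dot v v) ->
  quad_loss (E - (2 * eta) *: (E *m gram)) <= (1 - 2 / 3 * eta * lam) * quad_loss E.
Proof.
move=> lam0 eta0 etaL gramb; rewrite /quad_loss mulr_sumr; apply: ler_sum => i _.
have -> : (row i (E - (2 * eta) *: (E *m gram)))^T =
    (row i E)^T - (2 * eta) *: (gram *m (row i E)^T).
  by rewrite linearB linearZ /= linearB linearZ /= row_mul trmx_mul gram_tr.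
exact: (gradient_step_contraction gram_tr lam0 eta0 etaL gramb).
Qed.

Lemma empirical_loss_gd (lam Lam : R) theta K :
  0 < lam -> 0 < eta -> eta * Lam <= 5 / 6 -> 0 <= 1 - 2 / 3 * eta * lam ->
  (forall v, lam * dot v v <= dot v (gram *m v) <= Lam * dot v v) ->
  L (gd_iterate L eta theta K) <= (1 - 2 / 3 * eta * lam) ^+ K * L theta.
Proof.
move=> lam0 eta0 etaL c0 gramb; elim: K => [|K IH]; first by rewrite expr0 mul1r.
rewrite exprS -mulrA /gd_iterate iterS -/(gd_iterate L eta theta K).
apply: le_trans _ (ler_wpM2l c0 IH).
rewrite !empirical_lossE error_gd_step.
exact: (quad_loss_gd_step _ lam0 eta0 etaL gramb).
Qed.

(** This removes the derivatives from the iterates: the error becomes polynomial in the samples,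
    hence measurable. *)
Lemma error_gd_iterate theta K :
  error_mx (gd_iterate L eta theta K) =
  iter K (fun E => E - (2 * eta) *: (E *m gram)) (error_mx theta).
Proof.
by elim: K => [//|K IH]; rewrite /gd_iterate !iterS -IH -error_gd_step.
Qed.
End EmpiricalLoss.
End GradientDescent.

(** * Measurability of the success event *)

Section MeasurableMatrix.
Context (R : realType) (disp : measure_display) (T : measurableType disp).

Definition measurable_mx m n (F : T -> 'M[R]_(m, n)) : Prop :=
  forall i j, measurable_fun setT (fun w => F w i j).

Lemma measurable_mx_cst m n (A : 'M[R]_(m, n)) : measurable_mx (fun=> A).
Proof. by move=> i j; exact: measurable_cst. Qed.

Lemma measurable_mx_tr m n (F : T -> 'M[R]_(m, n)) :
  measurable_mx F -> measurable_mx (fun w => (F w)^T).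
Proof. by move=> mF i j; under eq_fun do rewrite mxE; exact: mF. Qed.

Lemma measurable_mx_row m n (F : T -> 'M[R]_(m, n)) k :
  measurable_mx F -> measurable_mx (fun w => row k (F w)).
Proof. by move=> mF i j; under eq_fun do rewrite mxE; exact: mF. Qed.

Lemma measurable_mxZ m n c (F : T -> 'M[R]_(m, n)) :
  measurable_mx F -> measurable_mx (fun w => c *: F w).
Proof.
by move=> mF i j; under eq_fun do rewrite mxE; apply: measurable_funM => //; exact: mF.
Qed.

Lemma measurable_mxD m n (F G : T -> 'M[R]_(m, n)) :
  measurable_mx F -> measurable_mx G -> measurable_mx (fun w => F w + G w).
Proof.
move=> mF mG i j; under eq_fun do rewrite mxE.
by apply: measurable_funD; [exact: mF|exact: mG].
Qed.

Lemma measurable_mx_sum m n I (s : seq I) (F : I -> T -> 'M[R]_(m, n)) :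
  (forall i, measurable_mx (F i)) -> measurable_mx (fun w => \sum_(i <- s) F i w).
Proof.
move=> mF i j; under eq_fun do rewrite summxE.
by apply: measurable_sum => k; exact: mF.
Qed.

Lemma measurable_mxM m n p (F : T -> 'M[R]_(m, n)) (G : T -> 'M[R]_(n, p)) :
  measurable_mx F -> measurable_mx G -> measurable_mx (fun w => F w *m G w).
Proof.
move=> mF mG i j; under eq_fun do rewrite mxE.
by apply: measurable_sum => k; apply: measurable_funM; [exact: mF|exact: mG].
Qed.

(** Monotonicity of the probability is applied to this set, which must therefore be measurable. *)
Lemma measurable_gd_loss d N (gamma : R) (mu b0 : 'cV[R]_d) (Sigma B1 : 'M[R]_d)
    (X : 'I_N -> T -> 'cV[R]_d) (eta : R) (theta : params R d) K eps :
  (forall n, measurable_mx (X n)) ->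
  let L w := empirical_loss gamma mu Sigma B1 b0 (fun n => X n w) in
  measurable [set w | L w (gd_iterate (L w) eta theta K) <= eps].
Proof.
move=> mX L.
have maug n : measurable_mx (fun w => augment (X n w)).
  move=> i j; case: (split_ordP i) => k ->.
    by under eq_fun do rewrite col_mxEu; exact: measurable_cst.
  by under eq_fun do rewrite col_mxEd; exact: mX.
have mgram : measurable_mx (fun w => gram (fun n => X n w)).
  apply: measurable_mxZ; apply: measurable_mx_sum => n.
  by apply: measurable_mxM => //; exact: measurable_mx_tr.
have merr : measurable_mx (fun w =>
    error_mx gamma mu b0 Sigma B1 (gd_iterate (L w) eta theta K)).
  rewrite (_ : (fun _ => _) = fun w => iter K (fun E => E + (- (2 * eta)) *:
    (E *m gram (fun n => X n w))) (error_mx gamma mu b0 Sigma B1 theta)).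
    elim: K => [|K IH]; first exact: measurable_mx_cst.
    by apply: measurable_mxD => //; apply: measurable_mxZ; exact: measurable_mxM.
  apply/funext => w; rewrite error_gd_iterate; apply: eq_iter => E.
  by rewrite scaleNr.
rewrite -[X in measurable X]setTI.
apply: (@measurable_fun_le _ _ _ setT _ (cst eps)) => //.
rewrite /L; under eq_fun do rewrite empirical_lossE.
apply: measurable_sum => i.
apply: (measurable_mxM (F := fun w => _)).
  by do 2! apply: measurable_mx_tr; exact: measurable_mx_row.
by apply: measurable_mxM => //; apply: measurable_mx_tr; exact: measurable_mx_row.
Qed.
End MeasurableMatrix.

(** * Concentration of the Gram matrix *)

Section Concentration.
Context (R : realType) (disp : measure_display) (T : measurableType disp).
Context (P : probability T R) (d : nat) (mu : 'cV[R]_d) (Sigma : 'M[R]_d).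
Context (N : nat) (X : 'I_N -> T -> 'cV[R]_d).
Hypothesis iidX : iid_gaussian P mu Sigma X.
Hypothesis Sigma_pos : posdef Sigma.

Lemma measurable_mx_sample n : measurable_mx (X n).
Proof.
move=> i j; rewrite ord1.
have := measurable_affine_form iidX 0 (delta_mx i 0) n.
congr measurable_fun; apply/funext => w.
by rewrite /= /affine_form add0r trmx_delta -rowE mxE.
Qed.

Lemma dot_augment y c (u : 'cV[R]_d) :
  dot (augment y) (col_mx c%:M u) = affine_form c u y.
Proof.
by rewrite /augment dot_col_mx dot_scalar_mx mul1r mxE eqxx mulr1n dotC.
Qed.

Lemma split_col_scalar (v : 'cV[R]_(1 + d)) :
  v = col_mx (usubmx v 0 0)%:M (dsubmx v).
Proof. by rewrite -mx11_scalar vsubmxK. Qed.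

(* The expectation of [augment x *m (augment x)^T] under N(mu, Sigma). *)
Definition population_gram : 'M[R]_(1 + d) :=
  augment mu *m (augment mu)^T + block_mx 0 0 0 Sigma.

Lemma dot_population_gram c (u : 'cV[R]_d) (v := col_mx c%:M u) :
  dot v (population_gram *m v) = second_moment mu Sigma c u.
Proof.
rewrite /population_gram mulmxDl dotDr /second_moment quadE -mulmxA.
rewrite [_^T *m v]mx11_scalar mul_mx_scalar -/(dot _ v) dotZr (dotC v).
rewrite dot_augment -expr2 /v mul_block_col !mul0mx !add0r dot_col_mx.
by rewrite /dot mulmx0 mxE add0r.
Qed.

Lemma dot_col_scalar c (u : 'cV[R]_d) :
  dot (col_mx c%:M u) (col_mx c%:M u) = c ^+ 2 + dot u u.
Proof. by rewrite dot_col_mx dot_scalar_mx mxE eqxx mulr1n expr2. Qed.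

Lemma measure_bigcup_seq_le (I : eqType) (s : seq I) (A : I -> set T) (b : R) :
  (forall i, measurable (A i)) -> (forall i, i \in s -> (P (A i) <= b%:E)%E) ->
  (P (\big[setU/set0]_(i <- s) A i) <= ((size s)%:R * b)%:E)%E.
Proof.
move=> mA; elim: s => [|i s IH] bA; first by rewrite big_nil measure0 mul0r.
rewrite big_cons (le_trans (measureU2 _ _ _))//.
  by apply: bigsetU_measurable.
rewrite -[X in X%:R]/(1 + size s)%N natrD mulrDl mul1r EFinD leeD//.
  by apply: bA; rewrite mem_head.
by apply: IH => j js; apply: bA; rewrite in_cons js orbT.
Qed.

Variable sigma : R.
Hypothesis sigmaS : smallest_eigenvalue Sigma sigma.
Local Notation lam := (lambda0 sigma mu).
Local Notation Lam := (1 + dot mu mu + opnorm2 Sigma).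

Lemma population_gram_bounds v :
  lam * dot v v <= dot v (population_gram *m v) <= Lam * dot v v.
Proof.
rewrite (split_col_scalar v) dot_population_gram dot_col_scalar.
by rewrite second_moment_lower// second_moment_upper.
Qed.

Lemma posdef_population_gram : posdef population_gram.
Proof.
split.
  rewrite /population_gram linearD /= trmx_mul trmxK tr_block_mx !trmx0.
  by have [-> _] := Sigma_pos.
move=> v v0; rewrite quadE.
have /andP[+ _] := population_gram_bounds v; apply: lt_le_trans.
have [l0 _ _] := lambda0_bounds mu (smallest_eigenvalue_gt0 Sigma_pos sigmaS).
by rewrite mulr_gt0// dot_gt0.
Qed.

(** A net point [z] is tested through [v = L^-T z], whose population form is exactly [|z|^2]; the
    tail bounds at [v] are then the hypotheses of the net argument for the whitened samples
    [L^-1 y]. Zero net points are left out, their second moment being zero. *)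
Lemma gram_concentration delta : (0 < d)%N -> 0 < delta -> delta < 1 ->
  300 * (d%:R - ln delta) <= N%:R ->
  exists B : set T, [/\ measurable B, (P B <= delta%:E)%E &
    forall w, ~ B w -> forall v,
      lam / 16 * dot v v <= dot v (gram (fun n => X n w) *m v)
        <= 5 / 2 * Lam * dot v v].
Proof.
move=> d0 delta0 delta1 hN.
have [L ME] := cholesky posdef_population_gram.
have Lu : L \in unitmx.
  by have := posdef_unitmx posdef_population_gram; rewrite ME unitmx_mul => /andP[].
pose z (f : net_index (1 + d)) := net_vector R f.
pose v f := (invmx L)^T *m z f.
pose c f := usubmx (v f) 0 0; pose u f := dsubmx (v f).
have LT x : dot x (population_gram *m x) = dot (L^T *m x) (L^T *m x).
  by rewrite ME -mulmxA dot_mulmx.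
have vK f : L^T *m v f = z f by rewrite mulmxA -trmx_mul mulVmx// trmx1 mul1mx.
have Vz f : second_moment mu Sigma (c f) (u f) = dot (z f) (z f).
  by rewrite -dot_population_gram -split_col_scalar LT vK.
pose Y f w n := affine_form (c f) (u f) (X n w).
pose U f := [set w | 2 * dot (z f) (z f) * N%:R <= \sum_n Y f w n ^+ 2].
pose D f := [set w | \sum_n Y f w n ^+ 2 <= dot (z f) (z f) / 4 * N%:R].
have mS f : measurable_fun setT (fun w => \sum_n Y f w n ^+ 2).
  by apply: measurable_sum => n; apply: measurable_funX; exact: (measurable_affine_form iidX).
have mU f : measurable (U f).
  rewrite -[X in measurable X]setTI.
  by apply: (@measurable_fun_le _ _ _ setT (cst _)).
have mD f : measurable (D f).
  rewrite -[X in measurable X]setTI.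
  by apply: (@measurable_fun_le _ _ _ setT _ (cst _)).
pose s := [seq f <- enum (net (1 + d)) | z f != 0].
have mUD f : measurable (U f `|` D f) by exact: measurableU.
exists (\big[setU/set0]_(f <- s) (U f `|` D f)); split.
- exact: bigsetU_measurable.
- pose b : R := 2 * expR (- (N%:R / 12)).
  apply: (le_trans (@measure_bigcup_seq_le _ s _ b mUD _)).
    move=> f; rewrite mem_filter => /andP[/dot_gt0 z0 _].
    rewrite (le_trans (measureU2 _ _ _))// /b mulr_natl mulr2n EFinD leeD//.
      by rewrite /U -Vz; apply: (second_moment_upper_tail iidX Sigma_pos); rewrite Vz.
    by rewrite /D -Vz; apply: (second_moment_lower_tail iidX Sigma_pos); rewrite Vz.
  rewrite lee_fin.
  have hs : (size s)%:R <= (2 ^+ (12 * (1 + d)) : R).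
    apply: le_trans (card_net R (1 + d)); rewrite ler_nat size_filter cardE.
    exact: count_size.
  have e2 : 2 <= expR 1 :> R by have := expR_ge1Dx (1 : R); lra.
  have : (size s)%:R * b <= expR 1 ^+ (12 * (1 + d)) * (expR 1 * expR (- (N%:R / 12))).
    apply: ler_pM => //; first by rewrite mulr_ge0// expR_ge0.
      by rewrite (le_trans hs)// lerXn2r ?nnegrE ?expR_ge0.
    by rewrite ler_wpM2r ?expR_ge0.
  move=> /le_trans; apply.
  rewrite -expRM_natl -!expRD mulr1 -[leRHS](@lnK _ delta) ?posrE// ler_expR.
  (* The exponent is [12 (d + 1) + 1 - N / 12], and [12 d + 13 <= 25 d]; this is the origin of 300 =
     12 * 25. *)
  have d1 : (1 : R) <= d%:R by rewrite ler1n.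
  have ln0 : ln delta < 0 by apply: ln_lt0; rewrite delta0.
  rewrite natrM natrD; lra.
- move=> w wB v'; set G := gram _.
  have N0 : (0 : R) < N%:R.
    apply: lt_le_trans hN; rewrite mulr_gt0// subr_gt0.
    by rewrite (lt_le_trans (ln_lt0 _))// delta0.
  pose a n := invmx L *m augment (X n w).
  have aE n x : dot (a n) x = dot (augment (X n w)) ((invmx L)^T *m x).
    by rewrite [RHS]dot_mulmx trmxK.
  have aY f n : dot (a n) (z f) = Y f w n.
    by rewrite aE -/(v f) (split_col_scalar (v f)) dot_augment.
  have GE : dot v' (G *m v') = mean_square a (L^T *m v').
    rewrite /G dot_gram /mean_square; congr (_ * _); apply: eq_bigr => n _.
    by rewrite aE mulmxA -trmx_mul mulmxV// trmx1 mul1mx.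
  have := @mean_square_net_bounds R (1 + d) N a isT.
  move=> /(_ _ (L^T *m v')) H.
  have {}H : dot (L^T *m v') (L^T *m v') / 16 <= mean_square a (L^T *m v')
      <= 5 / 2 * dot (L^T *m v') (L^T *m v').
    apply: H => f fnet z0.
    have fs : f \in s by rewrite mem_filter z0 mem_enum.
    have /not_orP[/negP hU /negP hD] : ~ (U f `|` D f) w.
      move=> UDw; apply: wB; rewrite -bigcup_seq; exists f => //.
    rewrite /mean_square; under eq_bigr do rewrite aY.
    rewrite -!/(z f) ler_pdivlMl// ler_pdivrMl//.
    rewrite /U /D /= -ltNge in hU; rewrite -ltNge in hD.
    by rewrite (mulrC N%:R) (ltW hD) (mulrC N%:R) (ltW hU).
  move: H; rewrite -LT -GE => /andP[H1 H2].
  have /andP[H3 H4] := population_gram_bounds v'.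
  apply/andP; split; lra.
Qed.
End Concentration.

(* C1, C2 are the constants of the two Omega's; they are absolute. The Omega in
   the number of steps is asymptotic as eps -> 0: for eps <= eps0 the condition
   on K reads K >= C2 * ln (eps^-1) / (eta * lambda0), and for eps > eps0 the
   number of steps required for eps0 is enough. *)
Theorem theorem1 (R : realType) :
  exists C1 C2 : R, 0 < C1 /\ 0 < C2 /\
  forall (d : nat) (gamma : R) (mu0 : 'cV[R]_d) (Sigma0 B1 : 'M[R]_d)
         (b0 : 'cV[R]_d) (sigma0 : R) (theta_init : params R d),
    (0 < d)%N -> 0 < gamma -> posdef Sigma0 ->
    smallest_eigenvalue Sigma0 sigma0 ->
  exists eps0 : R, 0 < eps0 /\
  forall (eps delta eta : R) (N K : nat)
         (disp : measure_display) (T : measurableType disp)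
         (P : probability T R) (X : 'I_N -> T -> 'cV[R]_d),
    let lam0 := lambda0 sigma0 mu0 in
    let L (w : T) := empirical_loss gamma mu0 Sigma0 B1 b0 (fun n => X n w) in
    iid_gaussian P mu0 Sigma0 X ->
    0 < eps -> 0 < delta -> delta < 1 ->
    C1 * (lam0 ^- 2 * (d%:R - ln delta)) <= N%:R ->
    0 < eta ->
    eta <= (4 / 3) / (8 * (1 + enorm mu0 ^+ 2) + 4 * opnorm2 Sigma0 + lam0) ->
    C2 * (ln (Num.min eps eps0)^-1 * (eta * lam0)^-1) <= K%:R ->
    ((1 - delta)%:E <=
       P [set w | (L w (gd_iterate (L w) eta theta_init K) <= eps)%R])%E.
Proof.
(* 48 is twice 24: the contraction rate is [eta lam0 / 24], and the number of steps is chosen to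
   reach [e ^+ 2] instead of [e]. *)
exists 300, 48; split=> //; split=> //.
move=> d gamma mu0 Sigma0 B1 b0 sigma0 theta_init d0 gamma0 Spos sS.
pose Lam := 1 + dot mu0 mu0 + opnorm2 Sigma0.
pose E0 := error_mx gamma mu0 b0 Sigma0 B1 theta_init.
pose S0 := \sum_i dot (row i E0)^T (row i E0)^T.
have S00 : 0 <= S0 by apply: sumr_ge0 => i _; exact: dot_ge0.
have Lam1 : 1 <= Lam by rewrite /Lam -addrA lerDl addr_ge0 ?dot_ge0 ?opnorm2_ge0.
(* On the good event this bounds the initial loss. It does not involve the samples, so [eps0] can be
   fixed before them. *)
pose D0 := 5 / 2 * Lam * S0.
have D00 : 0 <= D0 by rewrite mulr_ge0// mulr_ge0// (le_trans ler01).
have D1 : 0 < 1 + D0 by rewrite ltr_pwDl.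
exists (1 + D0)^-1; split; first by rewrite invr_gt0.
move=> eps delta eta N K disp T P X lam0 L iidX eps0 delta0 delta1 hN eta0 eta_le hK.
have [l0 l1 _] := lambda0_bounds mu0 (smallest_eigenvalue_gt0 Spos sS).
rewrite -/lam0 in l0 l1.
have ln0 : ln delta < 0 by apply: ln_lt0; rewrite delta0.
have {}hN : 300 * (d%:R - ln delta) <= N%:R.
  apply: le_trans hN; rewrite ler_wpM2l// ler_peMl//.
    by rewrite subr_ge0 (le_trans (ltW ln0)).
  by rewrite invf_ge1 ?exprn_gt0// exprn_ile1// ltW.
(* The denominator of the step size bound is at least [4 * Lam]. *)
have etaLam : eta * Lam <= 1 / 3.
  have := opnorm2_ge0 Sigma0; have := dot_ge0 mu0.
  move: eta_le; rewrite enorm_sqr ler_pdivlMr /Lam => [|]; last first.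
    by rewrite ltr_pwDr// addr_ge0// mulr_ge0 ?addr_ge0 ?dot_ge0 ?opnorm2_ge0.
  move=> H p0 o0.
  have := mulr_ge0 (ltW eta0) p0; have := mulr_ge0 (ltW eta0) o0.
  have := mulr_gt0 eta0 l0; lra.
have etal : eta * lam0 <= 1 / 3.
  by rewrite (le_trans _ etaLam)// ler_pM2l// (le_trans l1).
have [B [mB PB hB]] := gram_concentration iidX Spos sS d0 delta0 delta1 hN.
have mE : measurable [set w | L w (gd_iterate (L w) eta theta_init K) <= eps].
  by apply: measurable_gd_loss => n; exact: (measurable_mx_sample iidX).
apply: (@le_trans _ _ (P (~` B))).
  by rewrite probability_setC// EFinB leeB.
apply: le_measure; rewrite ?inE//; first exact: measurableC.
move=> w /= /hB gramb.
set e := Num.min eps (1 + D0)^-1 in hK.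
have e0 : 0 < e by rewrite lt_min eps0 invr_gt0.
have eD : e * D0 <= 1.
  apply: (@le_trans _ _ ((1 + D0)^-1 * D0)).
    by rewrite ler_wpM2r// ge_min lexx orbT.
  by rewrite ler_pdivrMl// mulr1 lerDr.
have := @empirical_loss_gd R d N gamma mu0 b0 Sigma0 B1 (fun n => X n w) eta
  (lam0 / 16) (5 / 2 * Lam) theta_init K.
set c := 1 - _ => H.
have c0 : 0 <= c by rewrite /c; lra.
apply: le_trans (H _ eta0 _ c0 gramb) _; [by rewrite divr_gt0|lra|].
have cE : c <= expR (- (eta * lam0 / 24)).
  by apply: le_trans (expR_ge1Dx _); rewrite /c; lra.
(* One factor [e] becomes the final accuracy, the other absorbs the initial loss through
   [e * D0 <= 1]. *)
have cK : c ^+ K <= e ^+ 2.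
  apply: (@le_trans _ _ (expR (- (eta * lam0 / 24)) ^+ K)).
    by rewrite lerXn2r ?nnegrE ?expR_ge0.
  rewrite -expRM_natl -[e in leRHS](@lnK _ e) ?posrE// -expRM_natl ler_expR.
  have el : 0 < eta * lam0 by rewrite mulr_gt0.
  move: hK; rewrite mulrA ler_pdivrMr// lnV ?posrE//.
  lra.
have L0 : L w theta_init <= D0.
  rewrite /L empirical_lossE /quad_loss /D0 mulr_sumr ler_sum// => i _.
  by have /andP[] := gramb (row i E0)^T.
have L00 : 0 <= L w theta_init.
  rewrite /L empirical_lossE sumr_ge0// => i _.
  by rewrite dot_gram mean_square_ge0.
apply: (@le_trans _ _ (e ^+ 2 * D0)).
  by rewrite ler_pM// exprn_ge0.
apply: (@le_trans _ _ e); last by rewrite ge_min lexx.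
by rewrite expr2 -mulrA ler_piMr// ltW.
Qed.
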